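(* (i) There is a generic (absolute) constant $C$ so that for any $T>0$, $M>r>0$ and $u_0\in L^2(\mathbb{R}^n)$ with $\mathrm{supp}\,u_0\subset B_r$, $$\int_{\mathbb{R}^n}|u(T,x)|^2\,dx\le\left(\frac1T+\frac{Cn}{(M-r)^2}\right)\int_0^T\int_{B_M}|u(t,x)|^2\,dx\,dt,$$ where $u$ is the solution of the heat equation with $u(0,\cdot)=u_0(\cdot)$. (ii) Assume that $0\le u_0\in L^1(\mathbb{R}^n)$ is such that $$\int_{B_r}u_0(x)\,dx\ge\mu\int_{\mathbb{R}^n}u_0(x)\,dx\quad\text{for some } r>0\text{ and }\mu\in(0,1).$$ Then for any $T>0$, $M>0$ and the solution $u$ of the heat equation with $u(0,\cdot)=u_0(\cdot)$, $$\int_{\mathbb{R}^n}|u(T,x)|^2\,dx\le\frac{2^{\frac n2+1}\pi^{\frac n2}T^{\frac n2-1}}{V_n\,(r\wedge M)^n\mu^2}\,e^{\frac{4r^2}{T}}\int_0^T\int_{B_M}|u(t,x)|^2\,dx\,dt,$$ where $r\wedge M:=\min\{r,M\}$.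
   Context: The heat equation is $\partial_t u-\Delta u=0$ in $(0,\infty)\times\mathbb{R}^n$. The solution with initial datum $u_0$ (in $L^2(\mathbb{R}^n)$ or $L^1(\mathbb{R}^n)$) is $u(t,x)=\int_{\mathbb{R}^n}(4\pi t)^{-n/2}e^{-\frac{|x-y|^2}{4t}}u_0(y)\,dy$ for $t>0$. $B_r$ is the open ball in $\mathbb{R}^n$ centered at $0$ of radius $r$; $V_n$ is the volume of the unit ball in $\mathbb{R}^n$; $\mathrm{supp}\,u_0$ denotes the set of points where $u_0$ does not vanish. *)

(* Defs.v *)
From HB Require Import structures.
From mathcomp Require Import all_boot all_order all_algebra.
From mathcomp Require Import all_classical all_reals all_analysis.

Set Implicit Arguments.
Unset Strict Implicit.
Unset Printing Implicit Defensive.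
Import Order.TTheory GRing.Theory Num.Theory.
Import numFieldNormedType.Exports.
Local Open Scope classical_set_scope.
Local Open Scope ring_scope.

(* R^n is [n.-tuple R]: the type that MathComp-Analysis equips with the product
   sigma-algebra, i.e. the Borel sets of R^n. *)

Definition tuple_cons (R : realType) (n : nat)
  (p : measurableTypeR R * n.-tuple R) : n.+1.-tuple R :=
  [tuple of (p.1 : R) :: p.2].

Lemma measurable_tuple_cons (R : realType) (n : nat) :
  measurable_fun setT (@tuple_cons R n).
Proof.
by apply: measurable_cons; [exact: measurable_fst|exact: measurable_snd].
Qed.

(* The image of lebesgue_measure \x mu under R * R^n ~ R^(n+1). *)
Definition lebesgue_cons (R : realType) (n : nat)
    (mu : {sigma_finite_measure set (n.-tuple R) -> \bar R}) :
    set (n.+1.-tuple R) -> \bar R :=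
  pushforward (@lebesgue_measure R \x mu)%E (@tuple_cons R n).

Section lebesgue_cons_measure.
Context (R : realType) (n : nat).
Variable mu : {sigma_finite_measure set (n.-tuple R) -> \bar R}.
Local Open Scope ereal_scope.

Let cons_preimage (A : set (n.+1.-tuple R)) :
  measurable A -> measurable (@tuple_cons R n @^-1` A).
Proof.
by move=> mA; rewrite -[X in measurable X]setTI; exact: measurable_tuple_cons.
Qed.

Let lebesgue_cons0 : lebesgue_cons mu set0 = 0.
Proof. by rewrite /lebesgue_cons /pushforward preimage_set0 measure0. Qed.

Let lebesgue_cons_ge0 A : 0 <= lebesgue_cons mu A.
Proof. exact: (measure_ge0 (@lebesgue_measure R \x mu)). Qed.

Let lebesgue_cons_sigma_additive : semi_sigma_additive (lebesgue_cons mu).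
Proof.
move=> F mF tF mUF; rewrite /lebesgue_cons /pushforward preimage_bigcup.
apply: measure_semi_sigma_additive.
- by move=> k; exact: cons_preimage.
- apply/trivIsetP => /= i j _ _ ij; rewrite -preimage_setI.
  by move/trivIsetP : tF => /(_ _ _ _ _ ij) ->//; rewrite preimage_set0.
- by rewrite -preimage_bigcup; exact: cons_preimage.
Qed.

HB.instance Definition _ := isMeasure.Build _ _ _ (lebesgue_cons mu)
  lebesgue_cons0 lebesgue_cons_ge0 lebesgue_cons_sigma_additive.

Let lebesgue_cons_sigma_finite : sigma_finite setT (lebesgue_cons mu).
Proof.
have /sigma_finiteP[F [TF ndF Foo]] := sigma_finiteT (@lebesgue_measure R).
have /sigma_finiteP[G [TG ndG Goo]] := sigma_finiteT mu.
pose h (x : n.+1.-tuple R) : measurableTypeR R * n.-tuple R :=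
  (thead x : R, [tuple of behead x]).
have mh : measurable_fun setT h.
  apply: measurable_fun_pair; last exact: measurable_behead.
  exact: (@measurable_tnth _ R n.+1 ord0).
have hK x : h (tuple_cons x) = x.
  case: x => a t; rewrite /h /tuple_cons theadE /=; congr pair.
  exact: val_inj.
exists (fun k => h @^-1` (F k `*` G k)).
  rewrite -preimage_bigcup; apply/esym/seteqP; split=> // x _ /=.
  have : setT (h x).1 by [].
  rewrite TF => -[i _ Fi].
  have : setT (h x).2 by [].
  rewrite TG => -[j _ Gj].
  exists (maxn i j) => //; split.
    by move: Fi; exact/subsetPset/ndF/leq_maxl.
  by move: Gj; exact/subsetPset/ndG/leq_maxr.
move=> k; have [mF Fk] := Foo k; have [mG Gk] := Goo k; split.
  by rewrite -[X in measurable X]setTI; apply: mh => //; exact: measurableX.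
rewrite /lebesgue_cons /pushforward (_ : _ @^-1` _ = F k `*` G k).
  by rewrite product_measure1E// lte_mul_pinfty// ge0_fin_numE.
by rewrite -comp_preimage (_ : h \o _ = id) ?preimage_id//; exact/funext.
Qed.

HB.instance Definition _ := Measure_isSigmaFinite.Build _ _ _ (lebesgue_cons mu)
  lebesgue_cons_sigma_finite.

End lebesgue_cons_measure.

(* n-dimensional Lebesgue measure; on R^0 = {[tuple]} it is the unit mass. *)
Fixpoint lebesgue_n (R : realType) (n : nat) :
    {sigma_finite_measure set (n.-tuple R) -> \bar R} :=
  match n with
  | 0 => [the {sigma_finite_measure set (0.-tuple R) -> \bar R}
            of dirac [tuple]]
  | m.+1 => [the {sigma_finite_measure set (m.+1.-tuple R) -> \bar R}
            of lebesgue_cons (lebesgue_n R m)]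
  end.

Lemma lebesgue_n_box (R : realType) (n : nat) (A : 'I_n -> set R) :
  (forall i, measurable (A i)) ->
  lebesgue_n R n [set x | forall i, A i (tnth x i)] =
  (\prod_(i < n) lebesgue_measure (A i))%E.
Proof.
elim: n A => [A _|n IH A mA].
  rewrite big_ord0 /= diracE mem_set//=; by case.
rewrite big_ord_recl /= /lebesgue_cons /pushforward.
rewrite (_ : _ @^-1` _ = A ord0 `*`
    [set x : n.-tuple R | forall i, A (lift ord0 i) (tnth x i)]); last first.
  apply/seteqP; split=> [[a t] /= H|[a t] /= [H0 H1] i].
    split=> [|i]; first exact: (H ord0).
    by have := H (lift ord0 i); rewrite tnthS.
  by have [j ->|->] := unliftP ord0 i; [rewrite tnthS; exact: H1|].
have mB : measurable [set x : n.-tuple R | forall i, A (lift ord0 i) (tnth x i)].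
  rewrite (_ : mkset _ = \bigcap_(i in [set: 'I_n])
      ((fun x : n.-tuple R => tnth x i) @^-1` A (lift ord0 i))); last first.
    by apply/seteqP; split=> x /= H i => [_|]; [exact: H|exact: (H i I)].
  apply: fin_bigcap_measurable => // i _.
  by rewrite -[X in measurable X]setTI; apply: measurable_tnth.
rewrite product_measure1E//; last exact: mA.
by congr (_ * _)%E; apply: IH => i; exact: mA.
Qed.

Definition enorm (R : realType) (n : nat) (x : n.-tuple R) : R :=
  Num.sqrt (\sum_(i < n) tnth x i ^+ 2).

Definition vsub (R : realType) (n : nat) (x y : n.-tuple R) : n.-tuple R :=
  [tuple tnth x i - tnth y i | i < n].

Definition eball (R : realType) (n : nat) (r : R) : set (n.-tuple R) :=
  [set x | enorm x < r].
Arguments eball {R} n r.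

Definition unit_ball_volume (R : realType) (n : nat) : R :=
  fine (lebesgue_n R n (eball n 1)).

Definition heat_kernel (R : realType) (n : nat) (t : R) (z : n.-tuple R) : R :=
  (4 * pi * t) `^ (- (n%:R / 2)) * expR (- (enorm z ^+ 2 / (4 * t))).

(* Meaningful for t > 0 only; the datum u0 is attained as t -> 0+. *)
Definition heat_solution (R : realType) (n : nat) (u0 : n.-tuple R -> R)
    (t : R) (x : n.-tuple R) : R :=
  \int[lebesgue_n R n]_y (heat_kernel t (vsub x y) * u0 y).

(* Not the topological support: no closure is taken. *)
Definition nonvanishing (R : realType) (n : nat) (u : n.-tuple R -> R) :
    set (n.-tuple R) :=
  [set x | u x != 0].

(* Main.v *)
Require Import Defs.
From mathcomp Require Import all_boot all_order all_algebra.
From mathcomp Require Import all_classical all_reals all_analysis.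
From mathcomp Require Import measurable_realfun.
From mathcomp Require Import ring lra.

Set Implicit Arguments.
Unset Strict Implicit.
Unset Printing Implicit Defensive.
Import Order.TTheory GRing.Theory Num.Theory.
Import numFieldNormedType.Exports.
Local Open Scope classical_set_scope.
Local Open Scope ring_scope.

(** Write [u t] for the solution at time [t], [P_h] for convolution with the
    heat kernel at time [h] and, for a weight [w >= 0],
    [E_w t] for the integral of [w * u t ^ 2].

    Everything rests on one discrete substitute for the fact that [u ^ 2] is a
    subsolution of the heat equation.  The kernel has mass one, so Jensen's
    inequality gives [(P_h v)^2 <= P_h (v^2)]; moving the symmetric kernel onto
    the weight, the integral of [w * (P_h v)^2] is at most the integral of
    [(P_h w) * v^2] ([heat_solution_weight_le]).  Together with the semigroup law
    ([heat_solution_semigroup]) every upper bound on [P_h w] becomes an inequality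
    between [E_w (t + h)] and energies at time [t].  No derivative of [u] and no
    integration by parts in space is ever taken.

    Data supported in the ball of radius [r].  With [w = 1] the energy is
    nonincreasing, hence [T * E_1 T] is at most the time integral of [E_1].  What
    lies outside the ball of radius [M] is controlled by the weight
    [w x = min (1, (dist (x, B_r) / (M - r))^2)].  It vanishes on [B_r], equals
    one outside [B_M], and at each point of [B_M] it is touched from above by the
    paraboloid [|y - c|^2 / (M - r)^2], where [c] is the point of the closed inner
    ball closest to the given one.  As the Gaussian second moment is of order
    [n * h], this gives [P_h w <= w + K * h * 1_{B_M}] with
    [K = 12 * n / (M - r)^2] ([heat_annulus_weight_le]), and hence
    [E_w (t + h) <= E_w t + K * h * E_{B_M} t], with no error term.  Initially
    [E_w] vanishes; summing over steps of length [T / N] and letting [N] go to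
    infinity bounds the time integral of [E_w] by [K * T] times that of [E_{B_M}]
    ([integral_time_steps_le]).  Since [1 <= w + 1_{B_M}], the estimate follows
    with [C = 12] ([heat_energy_le_time_integral]).

    Nonnegative data of mass [m].  The semigroup law turns [E_1 T] into the
    integral of [u (2 T) * u0], at most [(8 pi T)^(- n / 2) * m^2]
    ([heat_energy_le_mass]).  Conversely, for [T / 2 < t <= T] the points of [B_r] are
    at mutual distance at most [2 r], so on [B_r] the solution is at least
    [(4 pi T)^(- n / 2) * exp (- 2 r^2 / T)] times the mass [mu * m] inside [B_r]
    ([heat_solution_ge_local_mass]).  Squaring, and integrating over the second
    half of the time interval and over the ball of radius [min (r, M)], gives
    the stated constant exactly ([nonneg_constantE]). *)

(** * Integration over tuples *)

Section lebesgue_tuples.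
Context {R : realType}.
Implicit Types (n : nat) (a b c : R).
Local Notation leb := (@lebesgue_measure R).

(** Tonelli's theorem through the pushforward defining the measure: the
    induction step of all the dimension-[n] formulas below. *)
Lemma ge0_integral_lebesgue_cons n (f : n.+1.-tuple R -> \bar R) :
  measurable_fun [set: n.+1.-tuple R] f -> (forall x, 0 <= f x)%E ->
  (\int[lebesgue_n R n.+1]_x f x =
   \int[leb]_a \int[lebesgue_n R n]_x f (tuple_cons (a, x)))%E.
Proof.
move=> mf f0.
have mc := @measurable_tuple_cons R n.
have H := ge0_integral_pushforward mc (leb \x lebesgue_n R n)%E measurableT mf (in1W f0).
refine (etrans H _).
rewrite preimage_setT (fubini_tonelli1 (f \o @tuple_cons R n))//.
  exact: measurableT_comp.
by move=> x; exact: f0.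
Qed.

Lemma measurable_prod_tnth n (f : 'I_n -> R -> R) :
  (forall i, measurable_fun setT (f i)) ->
  measurable_fun setT (fun x : n.-tuple R => \prod_(i < n) f i (tnth x i)).
Proof.
move=> mf.
have := @measurable_prod _ (n.-tuple R) R setT 'I_n (index_enum _)
  (fun i x => f i (tnth x i)).
apply => i _; apply: measurableT_comp => //; exact: measurable_tnth.
Qed.

(** The one-dimensional integrals are required to be real numbers [c i], so that
    no product of [0] with an infinite factor can occur. *)
Lemma ge0_integral_prod_tnth n (f : 'I_n -> R -> R) (c : 'I_n -> R) :
  (forall i, measurable_fun setT (f i)) -> (forall i x, 0 <= f i x) ->
  (forall i, \int[leb]_x (f i x)%:E = (c i)%:E)%E ->
  (\int[lebesgue_n R n]_x (\prod_(i < n) f i (tnth x i))%:E =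
   (\prod_(i < n) c i)%:E)%E.
Proof.
elim: n f c => [|n IH] f c mf f0 fc.
  under eq_integral do rewrite big_ord0.
  rewrite big_ord0 integral_cst// mul1e; exact: diracT.
rewrite (@ge0_integral_lebesgue_cons n
  (fun x => (\prod_(i < n.+1) f i (tnth x i))%:E)); last 2 first.
- by apply/measurable_EFinP; exact: (measurable_prod_tnth mf).
- by move=> x; rewrite lee_fin prodr_ge0.
rewrite big_ord_recl EFinM -fc -ge0_integralZr//; last 3 first.
- by apply/measurable_EFinP; exact: mf.
- by move=> x _; rewrite lee_fin.
- rewrite lee_fin prodr_ge0// => i _.
  by rewrite -lee_fin -fc integral_ge0// => x _; rewrite lee_fin.
apply: eq_integral => a _.
rewrite -(IH (fun i => f (lift ord0 i)))// -ge0_integralZl//; last 3 first.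
- by apply/measurable_EFinP; exact: (@measurable_prod_tnth _ (fun i => f _)).
- by move=> x _; rewrite lee_fin prodr_ge0.
- by rewrite lee_fin.
apply: eq_integral => x _; rewrite big_ord_recl EFinM; congr (_ * (_)%:E)%E.
by apply: eq_bigr => i _; rewrite tnthS.
Qed.

End lebesgue_tuples.

(** * Affine changes of variable on the line *)

Section affine.
Context {R : realType}.
Implicit Types (n : nat) (a b c : R).
Local Notation leb := (@lebesgue_measure R).

Lemma measurable_affine a b :
  measurable_fun [set: measurableTypeR R]
    ((fun x : R => a * x + b) : measurableTypeR R -> measurableTypeR R).
Proof.
by apply: measurable_funD => //; apply: measurable_funM.
Qed.

(** Two measures agreeing on half-open intervals coincide. *)
Lemma lebesgue_measure_affine a b (A : set (measurableTypeR R)) : 0 < a ->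
  measurable A -> (a%:E * leb ((fun x : R => (a * x + b)%R) @^-1` A) = leb A)%E.
Proof.
move=> a0 mA; pose an : {nonneg R} := NngNum (ltW a0).
pose phi : measurableTypeR R -> measurableTypeR R := fun x => a * x + b.
have mphi : measurable_fun [set: measurableTypeR R] phi := measurable_affine a b.
pose P : {measure set (measurableTypeR R) -> \bar R} :=
  measure_function_pushforward__canonical__measure_function_Measure leb mphi.
apply/esym; transitivity (mscale an P A) => //.
apply: lebesgue_measure_unique => //= _ [[c d]] _ <-.
rewrite /mscale/= /pushforward.
have -> : phi @^-1` `]c, d]%classic = `](c - b) / a, (d - b) / a]%classic.
  apply/seteqP; split=> x /=; rewrite !in_itv/= /phi ltr_pdivrMr// ler_pdivlMr//;
   by rewrite ltrBlDr lerBrDr mulrC.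
rewrite !lebesgue_measure_itv/= !lte_fin ltr_pM2r ?invr_gt0// ltrBlDr subrK.
case: ifPn => // cd; last by rewrite mule0.
by rewrite -!EFinD -EFinM; congr (_%:E); field; rewrite gt_eqF.
Qed.

Lemma ge0_integral_affine a b (f : R -> \bar R) : 0 < a ->
  measurable_fun [set: R] f -> (forall x, 0 <= f x)%E ->
  (\int[leb]_x f x = a%:E * \int[leb]_x f (a * x + b)%R)%E.
Proof.
move=> a0 mf f0; pose an : {nonneg R} := NngNum (ltW a0).
pose phi : measurableTypeR R -> measurableTypeR R := fun x => a * x + b.
have mphi : measurable_fun [set: measurableTypeR R] phi := measurable_affine a b.
pose P : {measure set (measurableTypeR R) -> \bar R} :=
  measure_function_pushforward__canonical__measure_function_Measure leb mphi.
transitivity (\int[mscale an P]_x f x)%E.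
  by apply: eq_measure_integral => A mA _; exact/esym/lebesgue_measure_affine.
rewrite ge0_integral_mscale//; congr (_ * _)%E.
by rewrite ge0_integral_pushforward//.
Qed.

Lemma ge0_integral_reflect c (f : R -> \bar R) :
  measurable_fun [set: R] f -> (forall x, 0 <= f x)%E ->
  (\int[leb]_x f x = \int[leb]_x f (c - x)%R)%E.
Proof.
move=> mf f0.
transitivity (\int[leb]_x f (- x)%R)%E.
  transitivity (\int[pushforward leb (-%R : _ -> measurableTypeR R)]_x f x)%E.
    by apply: eq_measure_integral => A mA _; exact/esym/lebesgue_measureN.
  rewrite ge0_integral_pushforward//.
have mfN : measurable_fun [set: R] (fun x => f (- x)) by exact: measurableT_comp.
rewrite (@ge0_integral_affine 1 (- c) (fun x => f (- x)))// mul1e.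
by apply: eq_integral => x _; congr f; ring.
Qed.

End affine.

(** * One-dimensional Gaussians *)

Section gauss.
Context {R : realType}.
Implicit Types a b c k m x y z : R.
Local Notation leb := (@lebesgue_measure R).

(** The heat kernel of the line at time [k / 4]: in this parametrization
    convolution adds the parameters. *)
Definition gauss k z : R := (pi * k) `^ (- 2^-1) * expR (- (z ^+ 2 / k)).

Lemma gauss_ge0 k z : 0 <= gauss k z.
Proof. by rewrite mulr_ge0// ?powR_ge0// expR_ge0. Qed.

Lemma gaussN k z : gauss k (- z) = gauss k z.
Proof. by rewrite /gauss sqrrN. Qed.

Lemma gaussBC k x y : gauss k (x - y) = gauss k (y - x).
Proof. by rewrite -gaussN opprB. Qed.

Lemma measurable_gauss k : measurable_fun [set: R] (gauss k).
Proof.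
apply: measurable_funM => //; apply: measurableT_comp => //.
by apply: measurableT_comp => //; apply: measurable_funM => //; exact: measurable_funX.
Qed.

Lemma measurable_gauss_shift k m : measurable_fun [set: R] (fun y => gauss k (y - m)).
Proof. by apply: measurableT_comp; [exact: measurable_gauss|exact: measurable_funB]. Qed.

Lemma integral_gauss k m : 0 < k -> (\int[leb]_y (gauss k (y - m))%:E = 1)%E.
Proof.
move=> k0.
(* The integrand is the normal density of mean [m] and variance [k / 2]. *)
rewrite -(integral_normal_pdf m (Num.sqrt (k / 2))).
have s0 : Num.sqrt (k / 2) != 0 by rewrite gt_eqF// sqrtr_gt0 divr_gt0.
apply: eq_integral => y _; congr (_%:E).
rewrite normal_pdfE// /normal_peak /normal_fun sqr_sqrtr ?divr_ge0 ?ltW//.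
rewrite /gauss powRN powR12_sqrt ?mulr_ge0 ?pi_ge0 ?ltW//.
congr ((Num.sqrt _)^-1 * expR _); rewrite -mulr_natr; first by field.
by field; rewrite gt_eqF.
Qed.

Lemma integral_gaussZ a k m : 0 < k -> 0 <= a ->
  (\int[leb]_y (a * gauss k (y - m))%:E = a%:E)%E.
Proof.
move=> k0 a0; under eq_integral do rewrite EFinM.
rewrite ge0_integralZl ?integral_gauss ?mule1//.
- by apply/measurable_EFinP; exact: measurable_gauss_shift.
- by move=> y _; rewrite lee_fin gauss_ge0.
Qed.

(** Completing the square in [y]. *)
Lemma gauss_mul a b x y z : 0 < a -> 0 < b ->
  gauss a (x - y) * gauss b (y - z) =
  gauss (a + b) (x - z) * gauss (a * b / (a + b)) (y - (b * x + a * z) / (a + b)).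
Proof.
move=> a0 b0; have ab0 : 0 < a + b by rewrite addr_gt0.
rewrite /gauss mulrACA [RHS]mulrACA -!expRD; congr (_ * expR _).
  have pp c : 0 < c -> 0 <= pi * c by move=> c0; rewrite mulr_ge0 ?pi_ge0 ?ltW.
  rewrite -!powRM ?pp ?divr_gt0 ?mulr_gt0//.
  by congr (_ `^ _); field; rewrite gt_eqF.
by field; rewrite !gt_eqF.
Qed.

Lemma gauss_conv a b x z : 0 < a -> 0 < b ->
  (\int[leb]_y (gauss a (x - y) * gauss b (y - z))%:E = (gauss (a + b) (x - z))%:E)%E.
Proof.
move=> a0 b0; under eq_integral do rewrite gauss_mul//.
by rewrite integral_gaussZ ?gauss_ge0// divr_gt0 ?mulr_gt0 ?addr_gt0.
Qed.

(** From [s <= exp s] at [s = z ^+ 2 / (2 * k)], half of the Gaussian exponent absorbs the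
    quadratic factor; the remaining half is a Gaussian of parameter [2 * k], up to
    the factor [sqrt 2 <= 3 / 2]. *)
Lemma gauss_sqr_le k z : 0 < k -> gauss k z * z ^+ 2 <= 3 * k * gauss (2 * k) z.
Proof.
move=> k0.
have k2 : 0 < 2 * k by rewrite mulr_gt0.
have -> : gauss k z = (2 `^ (2^-1) * expR (- (z ^+ 2 / (2 * k)))) * gauss (2 * k) z.
  rewrite /gauss mulrACA -expRD.
  rewrite (_ : pi * (2 * k) = 2 * (pi * k)); last by ring.
  rewrite (@powRM _ 2)//; last by rewrite mulr_ge0 ?pi_ge0 ?ltW.
  rewrite mulrA -powRD; last by rewrite pnatr_eq0 implybT.
  rewrite subrr powRr0 mul1r; congr (_ * expR _).
  by field; rewrite gt_eqF.
rewrite mulrAC ler_wpM2r ?gauss_ge0//.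
have le1 : expR (- (z ^+ 2 / (2 * k))) * (z ^+ 2) <= 2 * k.
  rewrite expRN mulrC ler_pdivrMr ?expR_gt0// mulrC -ler_pdivrMr//.
  by apply: le_trans (expR_ge1Dx _); rewrite lerDr.
have le2 : 2 `^ (2^-1) <= 3 / 2 :> R.
  rewrite powR12_sqrt// -[leRHS]ger0_norm// -sqrtr_sqr ler_sqrt; last by rewrite sqr_ge0.
  by lra.
rewrite -mulrA; apply: le_trans (ler_pM _ _ le2 le1) _;
  rewrite ?powR_ge0 ?(mulr_ge0 (expR_ge0 _) (sqr_ge0 _))//.
lra.
Qed.

(** The reflection [y |-> 2 x - y] preserves the Gaussian centred at [x], and
    averaging [(y - c) ^+ 2] with its reflection leaves
    [(x - c) ^+ 2 + (y - x) ^+ 2]: the cross term disappears without any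
    integrability argument. *)
Lemma gauss_moment k x c : 0 < k ->
  (\int[leb]_y (gauss k (x - y) * (y - c) ^+ 2)%:E <= ((x - c) ^+ 2 + 3 * k)%:E)%E.
Proof.
move=> k0; set J := (\int[leb]_y _)%E.
have mg : measurable_fun [set: R] (fun y => gauss k (x - y)).
  by apply: measurableT_comp; [exact: measurable_gauss|exact: measurable_funB].
have mq d : measurable_fun [set: R] (fun y => (y - d) ^+ 2).
  by apply: measurable_funX; exact: measurable_funB.
have mJ : measurable_fun [set: R] (fun y => (gauss k (x - y) * (y - c) ^+ 2)%:E).
  by apply/measurable_EFinP; apply: measurable_funM.
have J0 y : (0 <= (gauss k (x - y) * (y - c) ^+ 2)%:E)%E.
  by rewrite lee_fin mulr_ge0 ?gauss_ge0 ?sqr_ge0.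
have JJ : (J + J <= (2 * ((x - c) ^+ 2 + 3 * k))%:E)%E.
  have mr : measurable_fun [set: R] (fun y => 2 * x - y) by exact: measurable_funB.
  rewrite {2}/J (ge0_integral_reflect (2 * x))// -ge0_integralD//; last first.
    exact: (measurableT_comp mJ mr).
  have x0 : 0 <= 2 * (x - c) ^+ 2 by rewrite mulr_ge0// sqr_ge0.
  have k60 : 0 <= 6 * k by rewrite mulr_ge0// ltW.
  have mgk a d : measurable_fun [set: R] (fun y => (a * gauss d (y - x))%:E).
    by apply/measurable_EFinP; apply: measurable_funM => //; exact: measurable_gauss_shift.
  apply: (@le_trans _ _ (\int[leb]_y ((2 * (x - c) ^+ 2 * gauss k (y - x))%:E +
     (6 * k * gauss (2 * k) (y - x))%:E))%E).
    apply: ge0_le_integral => //.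
    - by move=> y _; exact: adde_ge0.
    - by apply: emeasurable_funD => //; exact: (measurableT_comp mJ mr).
    - by apply: emeasurable_funD; exact: mgk.
    - move=> y _; rewrite -!EFinD lee_fin.
      rewrite [gauss k (x - (_ - _))](_ : _ = gauss k (x - y)); last first.
        by rewrite gaussBC; congr gauss; ring.
      rewrite [gauss k (x - y)]gaussBC.
      have := @gauss_sqr_le k (y - x) k0.
      rewrite -mulrDr (_ : (_ - c) ^+ 2 + _ =
        2 * (x - c) ^+ 2 + 2 * (y - x) ^+ 2); last by ring.
      by nra.
  rewrite ge0_integralD//=; last 4 first.
  - by move=> y _; rewrite lee_fin (mulr_ge0 x0)// gauss_ge0.
  - exact: mgk.
  - by move=> y _; rewrite lee_fin (mulr_ge0 k60)// gauss_ge0.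
  - exact: mgk.
  rewrite !integral_gaussZ ?mulr_gt0// -EFinD lee_fin.
  by rewrite le_eqVlt; apply/orP; left; apply/eqP; ring.
have Jfin : J \is a fin_num.
  rewrite ge0_fin_numE ?integral_ge0//.
  apply: le_lt_trans (le_trans _ JJ) (ltry _).
  by apply: leeDl; exact: integral_ge0.
move: JJ; rewrite -(fineK Jfin) -EFinD !lee_fin => JJ; lra.
Qed.

End gauss.

(** * The heat kernel *)

Section measurability.
Context {R : realType} d (T : measurableType d).

Lemma measurable_inv : measurable_fun [set: R] (@GRing.inv R).
Proof.
(* Real powers are known to be measurable; the exponent [- 1] gives the inverse
   on nonnegative numbers only. *)
rewrite (_ : GRing.inv =
    fun x => if 0 <= x then x `^ (- 1) else - ((- x) `^ (- 1))); last first.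
  apply/funext => x; case: ifPn => [x0|]; first by rewrite powR_inv1.
  by rewrite -ltNge => x0; rewrite powR_inv1 ?oppr_ge0 ?ltW// invrN opprK.
apply: measurable_fun_ifT.
- by apply: measurable_fun_ler.
- exact: measurable_powR.
- by apply: measurableT_comp => //; apply: (measurableT_comp (measurable_powR _)).
Qed.

Lemma measurable_enorm n : measurable_fun setT (@enorm R n).
Proof.
rewrite (_ : @enorm R n = fun x => (\sum_(i < n) tnth x i ^+ 2) `^ (2^-1)).
  apply: (measurableT_comp (measurable_powR _)).
  by apply: measurable_sum => i; apply: measurable_funX; exact: measurable_tnth.
apply/funext => x; rewrite powR12_sqrt// sumr_ge0// => i _; exact: sqr_ge0.
Qed.

Lemma measurable_vsub n (f g : T -> n.-tuple R) :
  measurable_fun setT f -> measurable_fun setT g ->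
  measurable_fun setT (fun x => vsub (f x) (g x)).
Proof.
move=> mf mg; apply/measurable_fun_tnthP => i.
rewrite (_ : _ \o _ = fun x => tnth (f x) i - tnth (g x) i); last first.
  by apply/funext => x /=; rewrite tnth_mktuple.
by apply: measurable_funB; apply: (measurableT_comp (@measurable_tnth _ R n i)).
Qed.

Lemma measurable_heat_kernel n (t : T -> R) (z : T -> n.-tuple R) :
  measurable_fun setT t -> measurable_fun setT z ->
  measurable_fun setT (fun x => heat_kernel (t x) (z x)).
Proof.
move=> mt mz; apply: measurable_funM.
  by apply: (measurableT_comp (measurable_powR _)); exact: measurable_funM.
apply: measurableT_comp => //; apply: measurableT_comp => //.
apply: measurable_funM.
  by apply: measurable_funX; exact: (measurableT_comp (@measurable_enorm n) mz).
by apply: (measurableT_comp measurable_inv); exact: measurable_funM.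
Qed.

End measurability.

Section heat_kernel.
Context {R : realType}.
Implicit Types (n : nat) (t h k : R).
Local Notation leb := (@lebesgue_measure R).

Lemma enorm_sqr n (x : n.-tuple R) : enorm x ^+ 2 = \sum_(i < n) tnth x i ^+ 2.
Proof. by rewrite sqr_sqrtr// sumr_ge0// => i _; exact: sqr_ge0. Qed.

Lemma enorm_ge0 n (x : n.-tuple R) : 0 <= enorm x.
Proof. exact: sqrtr_ge0. Qed.

Lemma tnth_le_enorm n (x : n.-tuple R) i : `|tnth x i| <= enorm x.
Proof.
rewrite -ler_sqr ?nnegrE ?enorm_ge0// real_normK ?num_real// enorm_sqr.
by rewrite (bigD1 i)//= lerDl sumr_ge0// => j _; exact: sqr_ge0.
Qed.

Lemma enormBC n (x y : n.-tuple R) : enorm (vsub x y) = enorm (vsub y x).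
Proof.
congr Num.sqrt; apply: eq_bigr => i _.
by rewrite !tnth_mktuple -sqrrN opprB.
Qed.

(** Product structure of the kernel, which reduces its integrals to the line. *)
Lemma heat_kernelE n t (z : n.-tuple R) :
  heat_kernel t z = \prod_(i < n) gauss (4 * t) (tnth z i).
Proof.
rewrite /heat_kernel enorm_sqr big_split/= prodr_const card_ord; congr (_ * _).
  rewrite (_ : 4 * pi * t = pi * (4 * t)); last by ring.
  rewrite -powR_mulrn ?powR_ge0// -powRrM; congr (_ `^ _).
  by rewrite mulNr mulrC.
by rewrite mulr_suml -sumrN expR_sum.
Qed.

Lemma heat_kernel_ge0 n t (z : n.-tuple R) : 0 <= heat_kernel t z.
Proof. by rewrite mulr_ge0 ?powR_ge0 ?expR_ge0. Qed.

Lemma heat_kernelBC n t (x y : n.-tuple R) :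
  heat_kernel t (vsub x y) = heat_kernel t (vsub y x).
Proof. by rewrite /heat_kernel enormBC. Qed.

Lemma heat_kernel_le n t (z : n.-tuple R) : 0 < t ->
  heat_kernel t z <= (4 * pi * t) `^ (- (n%:R / 2)).
Proof.
move=> t0; rewrite /heat_kernel ler_piMr ?powR_ge0// -expR0 ler_expR oppr_le0.
by rewrite divr_ge0 ?sqr_ge0// mulr_ge0// ltW.
Qed.

Lemma measurable_gaussl k x : measurable_fun [set: R] (fun y => gauss k (x - y)).
Proof. by under eq_fun do rewrite gaussBC; exact: measurable_gauss_shift. Qed.

Lemma integral_gaussl k x : 0 < k -> (\int[leb]_y (gauss k (x - y))%:E = 1)%E.
Proof. by move=> k0; under eq_integral do rewrite gaussBC; exact: integral_gauss. Qed.

Lemma integral_heat_kernel n t (x : n.-tuple R) : 0 < t ->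
  (\int[lebesgue_n R n]_y (heat_kernel t (vsub x y))%:E = 1)%E.
Proof.
move=> t0; have t40 : 0 < 4 * t by rewrite mulr_gt0.
under eq_integral => y _.
  rewrite heat_kernelE; under eq_bigr do rewrite tnth_mktuple; over.
rewrite (@ge0_integral_prod_tnth _ n (fun i y => gauss (4 * t) (tnth x i - y)) (fun=> 1)).
- by rewrite big1.
- by move=> i; exact: measurable_gaussl.
- by move=> i y; exact: gauss_ge0.
- by move=> i; exact: integral_gaussl.
Qed.

Lemma heat_kernel_conv n h t (x z : n.-tuple R) : 0 < h -> 0 < t ->
  (\int[lebesgue_n R n]_y
     (heat_kernel h (vsub x y) * heat_kernel t (vsub y z))%:E =
   (heat_kernel (h + t) (vsub x z))%:E)%E.
Proof.
move=> h0 t0.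
under eq_integral => y _.
  rewrite !heat_kernelE -big_split/=.
  under eq_bigr do rewrite !tnth_mktuple; over.
rewrite (@ge0_integral_prod_tnth _ n
  (fun i y => gauss (4 * h) (tnth x i - y) * gauss (4 * t) (y - tnth z i))
  (fun i => gauss (4 * h + 4 * t) (tnth x i - tnth z i))).
- rewrite heat_kernelE mulrDr; congr (_%:E).
  by apply: eq_bigr => i _; rewrite tnth_mktuple.
- by move=> i; apply: measurable_funM;
    [exact: measurable_gaussl|exact: measurable_gauss_shift].
- by move=> i y; rewrite mulr_ge0 ?gauss_ge0.
- by move=> i; rewrite gauss_conv// mulr_gt0.
Qed.

(** Expanding [|y - c|^2] over the coordinates, each summand is a product of
    one second moment and [n - 1] masses. *)
Lemma heat_kernel_moment n h (x c : n.-tuple R) : 0 < h ->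
  (\int[lebesgue_n R n]_y
     (heat_kernel h (vsub x y) * enorm (vsub y c) ^+ 2)%:E <=
   (enorm (vsub x c) ^+ 2 + 12 * n%:R * h)%:E)%E.
Proof.
move=> h0; have h40 : 0 < 4 * h by rewrite mulr_gt0.
(* [g i j] is the factor in the [j]-th coordinate of the [i]-th summand. *)
pose g (i j : 'I_n) (y : R) := gauss (4 * h) (tnth x j - y) *
  (if j == i then (y - tnth c i) ^+ 2 else 1).
pose J (i : 'I_n) := (\int[leb]_y (gauss (4 * h) (tnth x i - y) * (y - tnth c i) ^+ 2)%:E)%E.
have J0 i : (0 <= J i)%E.
  by apply: integral_ge0 => y _; rewrite lee_fin mulr_ge0 ?gauss_ge0 ?sqr_ge0.
have JE i : (J i <= ((tnth x i - tnth c i) ^+ 2 + 3 * (4 * h))%:E)%E.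
  exact: gauss_moment.
have Jfin i : J i \is a fin_num.
  by rewrite ge0_fin_numE//; apply: le_lt_trans (JE i) (ltry _).
have mg i j : measurable_fun [set: R] (g i j).
  apply: measurable_funM; first exact: measurable_gaussl.
  by case: (j == i) => //; apply: measurable_funX; exact: measurable_funB.
have g0 i j y : 0 <= g i j y.
  by rewrite mulr_ge0 ?gauss_ge0//; case: ifP => // _; exact: sqr_ge0.
have gE (y : n.-tuple R) : heat_kernel h (vsub x y) * enorm (vsub y c) ^+ 2 =
    \sum_(i < n) \prod_(j < n) g i j (tnth y j).
  rewrite heat_kernelE enorm_sqr mulr_sumr; apply: eq_bigr => i _.
  rewrite [RHS]big_split/= tnth_mktuple; congr (_ * _).
    by apply: eq_bigr => j _; rewrite tnth_mktuple.
  by rewrite -big_mkcond/= big_pred1_eq.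
under eq_integral do rewrite gE -sumEFin.
rewrite ge0_integral_sum//=; last 2 first.
- move=> i; apply/measurable_EFinP; exact: (measurable_prod_tnth (mg i)).
- by move=> i y _; rewrite lee_fin prodr_ge0.
apply: (@le_trans _ _ (\sum_(i < n) ((tnth x i - tnth c i) ^+ 2 + 3 * (4 * h))%:E)%E).
  apply: lee_sum => i _; apply: le_trans (JE i).
  rewrite (@ge0_integral_prod_tnth _ n (g i)
    (fun j => if j == i then fine (J i) else 1))//; last first.
    move=> j; rewrite /g; case: ifPn => [/eqP ->|_]; first by rewrite fineK.
    by under eq_integral do rewrite mulr1; exact: integral_gaussl.
  by rewrite -big_mkcond/= big_pred1_eq fineK.
rewrite sumEFin lee_fin big_split/= sumr_const card_ord enorm_sqr.
under [in leRHS]eq_bigr do rewrite tnth_mktuple.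
by rewrite lerD2l -mulr_natr le_eqVlt; apply/orP; left; apply/eqP; ring.
Qed.

End heat_kernel.

(** * The heat operator on functions *)

Section heat_operator.
Context {R : realType} {n : nat}.
Implicit Types (t : R) (x y : n.-tuple R) (f : n.-tuple R -> R).
Local Notation mu := (lebesgue_n R n).

(** Under this condition the totalized integral defining [heat_solution] is a
    genuine one for all positive times. *)
Definition heat_integrable f := forall t x, 0 < t ->
  mu.-integrable setT (fun y => (heat_kernel t (vsub x y) * f y)%:E).

Lemma measurable_heat_kernelB t :
  measurable_fun setT (fun p : n.-tuple R * n.-tuple R => heat_kernel t (vsub p.1 p.2)).
Proof.
apply: measurable_heat_kernel => //.
exact: measurable_vsub.
Qed.

Lemma measurable_heat_kernell t x : measurable_fun setT (fun y => heat_kernel t (vsub x y)).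
Proof.
apply: measurable_heat_kernel => //.
exact: measurable_vsub.
Qed.

Lemma integrable_heat_kernel t x : 0 < t ->
  mu.-integrable setT (fun y => (heat_kernel t (vsub x y))%:E).
Proof.
move=> t0; apply/integrableP; split.
  by apply/measurable_EFinP; exact: measurable_heat_kernell.
under eq_integral do rewrite gee0_abs ?lee_fin ?heat_kernel_ge0//.
by rewrite integral_heat_kernel// ltry.
Qed.

Lemma heat_solutionE f t x : heat_integrable f -> 0 < t ->
  (heat_solution f t x)%:E = (\int[mu]_y (heat_kernel t (vsub x y) * f y)%:E)%E.
Proof.
by move=> fi t0; rewrite /heat_solution /Rintegral fineK// integrable_fin_num//; exact: fi.
Qed.

Lemma measurable_heat_solution f : measurable_fun setT f ->
  measurable_fun setT (fun p : measurableTypeR R * n.-tuple R => heat_solution f p.1 p.2).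
Proof.
move=> mf.
pose F (q : (measurableTypeR R * n.-tuple R) * n.-tuple R) : \bar R :=
  (heat_kernel q.1.1 (vsub q.1.2 q.2) * f q.2)%:E.
have mF : measurable_fun setT F.
  apply/measurable_EFinP; apply: measurable_funM; last exact: measurableT_comp.
  apply: measurable_heat_kernel; first exact: measurableT_comp.
  by apply: measurable_vsub => //; exact: measurableT_comp.
have mP : measurable_fun setT (fubini_F mu (F^\+)%E).
  by apply: measurable_fun_fubini_tonelli_F => //; exact: measurable_funepos.
have mN : measurable_fun setT (fubini_F mu (F^\-)%E).
  by apply: measurable_fun_fubini_tonelli_F => //; exact: measurable_funeneg.
(* Tonelli's theorem gives measurability of parametrized integrals of nonnegative
   functions only, hence the two parts. *)
rewrite (_ : (fun p => _) =
    fine \o (fubini_F mu (F^\+)%E \- fubini_F mu (F^\-)%E)%E); last first.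
  apply/funext => p; rewrite /heat_solution /Rintegral integralE /fubini_F/=.
  by congr (fine (_ - _)%E); apply: eq_integral => y _; rewrite ?funeposE ?funenegE.
apply: measurableT_comp; first exact: fine_measurable.
exact: (emeasurable_funB mP mN).
Qed.

Lemma measurable_heat_solution_at f t : measurable_fun setT f ->
  measurable_fun setT (heat_solution f t).
Proof.
move=> mf; exact: (measurableT_comp (measurable_heat_solution mf) (pair1_measurable t)).
Qed.

(** Jensen's inequality for the probability density [y |-> heat_kernel t (x - y)]:
    integrate [2 m v <= v ^+ 2 + m ^+ 2] with [m] the mean of [v = f y]. *)
Lemma heat_solution_sqr_le f t x : measurable_fun setT f -> heat_integrable f -> 0 < t ->
  (((heat_solution f t x) ^+ 2)%:E <=
   \int[mu]_y (heat_kernel t (vsub x y) * f y ^+ 2)%:E)%E.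
Proof.
move=> mf fi t0; set m := heat_solution f t x.
set S := (\int[mu]_y _)%E.
have kf0 y : 0 <= heat_kernel t (vsub x y) * f y ^+ 2.
  by apply: mulr_ge0; [exact: heat_kernel_ge0|exact: sqr_ge0].
have S0 : (0 <= S)%E by apply: integral_ge0 => y _; rewrite lee_fin.
have mk := @measurable_heat_kernell t x.
have mS : measurable_fun setT (fun y => (heat_kernel t (vsub x y) * f y ^+ 2)%:E).
  by apply/measurable_EFinP; apply: measurable_funM => //; exact: measurable_funX.
have [->|Soo] := eqVneq S +oo%E; first by rewrite leey.
have Si : mu.-integrable setT (fun y => (heat_kernel t (vsub x y) * f y ^+ 2)%:E).
  apply/integrableP; split => //; under eq_integral do rewrite gee0_abs ?lee_fin ?kf0//.
  by rewrite -/S ltey.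
have Ki := integrable_heat_kernel x t0.
have := fi _ x t0; have := heat_solutionE x fi t0; rewrite -/m => mE Fi.
have : (\int[mu]_y ((2 * m)%:E * (heat_kernel t (vsub x y) * f y)%:E) <=
        \int[mu]_y ((heat_kernel t (vsub x y) * f y ^+ 2)%:E +
                    (m ^+ 2)%:E * (heat_kernel t (vsub x y))%:E))%E.
  apply: le_integral => //.
  - exact: integrableZl.
  - by apply: integrableD => //; exact: integrableZl.
  - move=> y _; rewrite -!EFinM -EFinD lee_fin.
    rewrite -subr_ge0 (_ : _ - _ = heat_kernel t (vsub x y) * (f y - m) ^+ 2); last by ring.
    by rewrite mulr_ge0 ?sqr_ge0 ?heat_kernel_ge0.
rewrite integralZl// -mE integralD//; last exact: integrableZl.
rewrite integralZl// integral_heat_kernel// mule1 -/S.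
have Sf : S \is a fin_num by rewrite ge0_fin_numE// ltey.
rewrite -(fineK Sf) -EFinM -EFinD !lee_fin; nra.
Qed.

(** Jensen's inequality, then Tonelli's theorem and the symmetry of the kernel
    to make the heat operator act on the weight. *)
Lemma heat_solution_weight_le f t (w w' : n.-tuple R -> R) : 0 < t ->
  measurable_fun setT f -> heat_integrable f ->
  measurable_fun setT w -> (forall x, 0 <= w x) ->
  measurable_fun setT w' ->
  (forall y, \int[mu]_x (heat_kernel t (vsub y x) * w x)%:E <= (w' y)%:E)%E ->
  (\int[mu]_x (w x * heat_solution f t x ^+ 2)%:E <=
   \int[mu]_y (w' y * f y ^+ 2)%:E)%E.
Proof.
move=> t0 mf fi mw w0 mw' ww'.
have mu1 := @measurable_heat_solution_at f t mf.
pose F (p : n.-tuple R * n.-tuple R) : \bar R :=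
  (w p.1 * (heat_kernel t (vsub p.1 p.2) * f p.2 ^+ 2))%:E.
have F0 p : (0 <= F p)%E.
  by rewrite lee_fin mulr_ge0// mulr_ge0 ?sqr_ge0 ?heat_kernel_ge0.
have mF : measurable_fun setT F.
  apply/measurable_EFinP; apply: measurable_funM; first exact: measurableT_comp.
  apply: measurable_funM; first exact: measurable_heat_kernelB.
  by apply: measurable_funX; exact: measurableT_comp.
apply: (@le_trans _ _ (\int[mu]_x \int[mu]_y F (x, y))%E).
  apply: ge0_le_integral => //.
  - by move=> x _; rewrite lee_fin mulr_ge0 ?sqr_ge0.
  - by apply/measurable_EFinP; apply: measurable_funM => //; exact: measurable_funX.
  - exact: (measurable_fun_fubini_tonelli_F _ mF).
  - move=> x _; rewrite EFinM.
    rewrite /F/=; under eq_integral do rewrite EFinM.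
    rewrite ge0_integralZl//.
    + by apply: lee_pmul => //; rewrite ?lee_fin ?sqr_ge0//; exact: heat_solution_sqr_le.
    + apply/measurable_EFinP; apply: measurable_funM; first exact: measurable_heat_kernell.
      exact: measurable_funX.
    + by move=> y _; rewrite lee_fin mulr_ge0 ?sqr_ge0 ?heat_kernel_ge0.
    + by rewrite lee_fin.
rewrite fubini_tonelli//; apply: ge0_le_integral => //.
- by move=> y _; apply: integral_ge0.
- exact: (measurable_fun_fubini_tonelli_G _ mF).
- by apply/measurable_EFinP; apply: measurable_funM => //; exact: measurable_funX.
- move=> y _; rewrite /F/=.
  under eq_integral => x _.
    rewrite mulrA [w x * _]mulrC heat_kernelBC EFinM; over.
  rewrite ge0_integralZr//.
  + by rewrite [leRHS]EFinM; apply: lee_wpmul2r => //; rewrite lee_fin sqr_ge0.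
  + by apply/measurable_EFinP; apply: measurable_funM => //; exact: measurable_heat_kernell.
  + by move=> x _; rewrite lee_fin mulr_ge0 ?heat_kernel_ge0.
  + by rewrite lee_fin sqr_ge0.
Qed.

End heat_operator.

(** * Integrability and the semigroup law *)

Section heat_semigroup.
Context {R : realType} {n : nat}.
Implicit Types (t h : R) (x y z : n.-tuple R) (f : n.-tuple R -> R).
Local Notation mu := (lebesgue_n R n).

(** Since [0 <= k <= c], one has [k * |a| <= k ^+ 2 + a ^+ 2 <= c * k + a ^+ 2],
    and the kernel [k] is integrable. *)
Lemma heat_integrable_sqr f : measurable_fun setT f ->
  mu.-integrable setT (fun y => (f y ^+ 2)%:E) -> heat_integrable f.
Proof.
move=> mf f2 t x t0; set c := (4 * pi * t) `^ (- (n%:R / 2)).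
have mk := @measurable_heat_kernell R n t x.
have i1 : mu.-integrable setT
    (fun y => (c%:E * (heat_kernel t (vsub x y))%:E + (f y ^+ 2)%:E)%E).
  by apply: integrableD => //; apply: integrableZl => //; exact: integrable_heat_kernel.
apply: le_integrable i1 => //.
  by apply/measurable_EFinP; exact: measurable_funM.
move=> y _; rewrite -EFinM -EFinD lee_fin.
have k0 := heat_kernel_ge0 t (vsub x y); have kc := heat_kernel_le (vsub x y) t0.
rewrite normrM (ger0_norm k0) [leRHS]ger0_norm; last first.
  by apply: addr_ge0; [rewrite mulr_ge0// powR_ge0|exact: sqr_ge0].
rewrite -[f y ^+ 2]real_normK ?num_real//.
move: k0 kc (normr_ge0 (f y)); rewrite -/c.
move: (heat_kernel _ _) `|f y| => k a k0 kc a0.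
have := mulr_ge0 k0 a0; have : 0 <= k * (c - k) by rewrite mulr_ge0// subr_ge0.
by have := sqr_ge0 (k - a); nra.
Qed.

Lemma integrable_heat_integrable f : mu.-integrable setT (EFin \o f) -> heat_integrable f.
Proof.
move=> fi t x t0; set c := (4 * pi * t) `^ (- (n%:R / 2)).
have mf : measurable_fun setT f by apply/measurable_EFinP; exact: measurable_int fi.
have mk := @measurable_heat_kernell R n t x.
apply: le_integrable (integrableZl _ c fi) => //.
  by apply/measurable_EFinP; exact: measurable_funM.
move=> y _; rewrite /= lee_fin !normrM; apply: ler_wpM2r => //.
by rewrite !ger0_norm ?heat_kernel_ge0 ?powR_ge0//; exact: heat_kernel_le.
Qed.

Section semigroup.
Variables (f : n.-tuple R -> R) (h t : R).
Hypotheses (mf : measurable_fun setT f) (fi : heat_integrable f) (h0 : 0 < h) (t0 : 0 < t).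

Let F x (p : n.-tuple R * n.-tuple R) : \bar R :=
  (heat_kernel h (vsub x p.1) * (heat_kernel t (vsub p.1 p.2) * f p.2))%:E.

Let mF x : measurable_fun setT (F x).
Proof.
apply/measurable_EFinP; apply: measurable_funM.
  exact: (measurableT_comp (measurable_heat_kernell h x)).
apply: measurable_funM; first exact: measurable_heat_kernelB.
exact: measurableT_comp.
Qed.

Let mK x z : measurable_fun setT
  (fun y => (heat_kernel h (vsub x y) * heat_kernel t (vsub y z))%:E).
Proof.
apply/measurable_EFinP; apply: measurable_funM; first exact: measurable_heat_kernell.
by under eq_fun do rewrite heat_kernelBC; exact: measurable_heat_kernell.
Qed.

Let K0 x z y : (0 <= (heat_kernel h (vsub x y) * heat_kernel t (vsub y z))%:E)%E.
Proof. by rewrite lee_fin mulr_ge0 ?heat_kernel_ge0. Qed.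

Let FE x z y : F x (y, z) =
  ((heat_kernel h (vsub x y) * heat_kernel t (vsub y z))%:E * (f z)%:E)%E.
Proof. by rewrite /F/= mulrA EFinM. Qed.

Let iK x z : mu.-integrable setT
  (fun y => (heat_kernel h (vsub x y) * heat_kernel t (vsub y z))%:E).
Proof.
apply/integrableP; split => //.
by under eq_integral do rewrite gee0_abs//; rewrite heat_kernel_conv// ltry.
Qed.

Let iF x : (mu \x mu)%E.-integrable setT (F x).
Proof.
apply/integrable21ltyP => //.
have /integrableP[_] := @fi (h + t) x (addr_gt0 h0 t0).
rewrite (_ : (\int[mu]_y _)%E = \int[mu]_z \int[mu]_y `|F x (y, z)|)%E//.
apply: eq_integral => z _.
under [RHS]eq_integral do rewrite FE abseM gee0_abs//.
rewrite ge0_integralZr// heat_kernel_conv// EFinM abseM.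
by rewrite gee0_abs ?lee_fin ?heat_kernel_ge0.
Qed.

Let FyE x y : (\int[mu]_z F x (y, z) =
  (heat_kernel h (vsub x y) * heat_solution f t y)%:E)%E.
Proof.
rewrite /F/= EFinM heat_solutionE// -integralZl//; last exact: fi.
Qed.

Lemma integrable_heat_kernel_solution x : mu.-integrable setT
  (fun y => (heat_kernel h (vsub x y) * heat_solution f t y)%:E).
Proof.
have := integrable_fubini_F (iF x).
by apply: eq_integrable => // y _; rewrite /fubini_F FyE.
Qed.

(** Fubini's theorem; by the convolution law of the kernels, the absolute integrability it
    needs is the one assumed at time [h + t]. *)
Lemma heat_solution_semigroup x :
  heat_solution f (h + t) x = heat_solution (heat_solution f t) h x.
Proof.
rewrite {2}/heat_solution /Rintegral; under eq_integral do rewrite -FyE.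
rewrite (Fubini (iF x)) /heat_solution /Rintegral; congr fine.
apply: eq_integral => z _; under [RHS]eq_integral do rewrite FE.
by rewrite integralZr// heat_kernel_conv.
Qed.

End semigroup.

Lemma heat_integrable_solution f t : measurable_fun setT f -> heat_integrable f ->
  0 < t -> heat_integrable (heat_solution f t).
Proof. by move=> mf fi t0 h x h0; exact: integrable_heat_kernel_solution. Qed.

End heat_semigroup.

(** * A weight vanishing on the inner ball *)

Section weight.
Context {R : realType} {n : nat}.
Implicit Types (h r M : R) (x y c : n.-tuple R).
Local Notation mu := (lebesgue_n R n).

(** Cauchy-Schwarz, from the sum of squares of [|y| x_i - |x| y_i]. *)
Lemma enorm_dot x y : \sum_(i < n) tnth x i * tnth y i <= enorm x * enorm y.
Proof.
have [x0|x0] := eqVneq (enorm x) 0.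
  have z0 i : tnth x i = 0 by apply/eqP; rewrite -normr_le0 -x0 tnth_le_enorm.
  by rewrite big1 ?x0 ?mul0r// => i _; rewrite z0 mul0r.
have [y0|y0] := eqVneq (enorm y) 0.
  have z0 i : tnth y i = 0 by apply/eqP; rewrite -normr_le0 -y0 tnth_le_enorm.
  by rewrite big1 ?y0 ?mulr0// => i _; rewrite z0 mulr0.
have xy0 : 0 < enorm x * enorm y by rewrite mulr_gt0// lt0r ?x0 ?y0 enorm_ge0.
have : 0 <= \sum_(i < n) (enorm y * tnth x i - enorm x * tnth y i) ^+ 2.
  by apply: sumr_ge0 => i _; exact: sqr_ge0.
rewrite (eq_bigr (fun i => enorm y ^+ 2 * tnth x i ^+ 2 + enorm x ^+ 2 * tnth y i ^+ 2 -
   2 * (enorm x * enorm y) * (tnth x i * tnth y i))); last by move=> i _; ring.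
rewrite sumrB big_split/= -!mulr_sumr -!enorm_sqr => H.
by rewrite -(ler_pM2l xy0); nra.
Qed.

Lemma enorm_triangle x y : enorm x <= enorm (vsub x y) + enorm y.
Proof.
rewrite -ler_sqr ?nnegrE ?addr_ge0 ?enorm_ge0// sqrrD.
rewrite !enorm_sqr.
apply: (@le_trans _ _ (\sum_(i < n) tnth (vsub x y) i ^+ 2 +
   (\sum_(i < n) tnth (vsub x y) i * tnth y i) *+ 2 + \sum_(i < n) tnth y i ^+ 2)).
  rewrite -sumrMnl -!big_split/= le_eqVlt; apply/orP; left; apply/eqP.
  by apply: eq_bigr => i _; rewrite tnth_mktuple; ring.
by rewrite lerD2r lerD2l lerMn2r/= enorm_dot.
Qed.

(** [(dist (x, B_r) / (M - r))^2] truncated at [1]. *)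
Definition annulus_weight r M x : R :=
  Num.min 1 ((Num.max 0 (enorm x - r) / (M - r)) ^+ 2).

Lemma annulus_weight_ge0 r M x : 0 <= annulus_weight r M x.
Proof. by rewrite le_min ler01 sqr_ge0. Qed.

Lemma annulus_weight_le1 r M x : annulus_weight r M x <= 1.
Proof. by rewrite ge_min lexx. Qed.

Lemma measurable_annulus_weight r M : measurable_fun setT (annulus_weight r M).
Proof.
apply: measurable_minr => //; apply: measurable_funX; apply: measurable_funM => //.
by apply: measurable_maxr => //; apply: measurable_funB => //; exact: measurable_enorm.
Qed.

Lemma annulus_weight_in r M x : enorm x <= r -> annulus_weight r M x = 0.
Proof.
move=> xr; rewrite /annulus_weight max_l ?subr_le0// mul0r expr0n/=.
by rewrite min_r.
Qed.

Lemma annulus_weight_out r M x : r < M -> M <= enorm x -> annulus_weight r M x = 1.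
Proof.
move=> rM Mx; rewrite /annulus_weight min_l// max_r; last by rewrite subr_ge0; lra.
by rewrite exprn_ege1// ler_pdivlMr ?subr_gt0// mul1r; lra.
Qed.

Lemma annulus_weight_le r M c y : r < M -> enorm c <= r ->
  annulus_weight r M y <= (M - r) ^- 2 * enorm (vsub y c) ^+ 2.
Proof.
move=> rM cr; rewrite ge_min; apply/orP; right.
rewrite expr_div_n mulrC ler_wpM2l ?invr_ge0 ?sqr_ge0//.
rewrite ler_sqr ?nnegrE ?enorm_ge0 ?le_max ?lexx//.
by rewrite ge_max enorm_ge0/=; have := enorm_triangle y c; lra.
Qed.

(** The point [c] is the projection of [x] on the closed ball of radius [r];
    with [annulus_weight_le] it says that the paraboloid centred at [c] touches the
    weight from above at [x]. *)
Lemma annulus_weight_touch r M x : 0 < r -> r < M -> enorm x < M ->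
  exists2 c, enorm c <= r &
    (M - r) ^- 2 * enorm (vsub x c) ^+ 2 = annulus_weight r M x.
Proof.
move=> r0 rM xM; have [xr|rx] := leP (enorm x) r.
  exists x => //; rewrite annulus_weight_in// (_ : enorm _ = 0) ?expr0n ?mulr0//.
  rewrite /enorm big1 ?sqrtr0// => i _.
  by rewrite tnth_mktuple subrr expr0n.
have x0 : 0 < enorm x by lra.
pose c := [tuple r / enorm x * tnth x i | i < n]; exists c.
  rewrite -ler_sqr ?nnegrE ?enorm_ge0 ?(ltW r0)// enorm_sqr.
  under eq_bigr do rewrite tnth_mktuple exprMn.
  by rewrite -mulr_sumr -enorm_sqr -exprMn divfK ?gt_eqF.
have -> : enorm (vsub x c) ^+ 2 = (enorm x - r) ^+ 2.
  rewrite enorm_sqr.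
  under eq_bigr do rewrite !tnth_mktuple -{1}[tnth x _]mul1r -mulrBl exprMn.
  rewrite -mulr_sumr -enorm_sqr -exprMn mulrBl mul1r divfK ?gt_eqF//.
rewrite /annulus_weight max_r ?subr_ge0 ?ltW// expr_div_n mulrC min_r//.
rewrite -expr_div_n; apply: exprn_ile1; first by rewrite divr_ge0 ?subr_ge0 ?ltW.
by rewrite ler_pdivrMr ?subr_gt0//; lra.
Qed.

Lemma measurable_eball M : measurable (@eball R n M).
Proof.
rewrite (_ : eball n M = @enorm R n @^-1` `]-oo, M[%classic).
  by rewrite -[X in measurable X]setTI; exact: measurable_enorm.
by apply/seteqP; split => x; rewrite /= in_itv.
Qed.

(** Outside the ball of radius [M] the weight equals its maximum [1], which the
    heat operator does not exceed; inside, the touching paraboloid is a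
    majorant whose image is explicitly bounded. *)
Lemma heat_annulus_weight_le r M h x : 0 < r -> r < M -> 0 < h ->
  (\int[mu]_y (heat_kernel h (vsub x y) * annulus_weight r M y)%:E <=
   (annulus_weight r M x + 12 * n%:R / (M - r) ^+ 2 * h * \1_(eball n M) x)%:E)%E.
Proof.
move=> r0 rM h0; have mw := @measurable_annulus_weight r M.
have mk := @measurable_heat_kernell R n h x.
have mkw : measurable_fun setT (fun y => (heat_kernel h (vsub x y) * annulus_weight r M y)%:E).
  by apply/measurable_EFinP; exact: measurable_funM.
have kw0 y : (0 <= (heat_kernel h (vsub x y) * annulus_weight r M y)%:E)%E.
  by rewrite lee_fin mulr_ge0 ?heat_kernel_ge0 ?annulus_weight_ge0.
have [Mx|xM] := leP M (enorm x).
  rewrite indicE memNset ?mulr0 ?addr0 ?annulus_weight_out//; last first.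
    by rewrite /eball/=; apply/negP; rewrite -leNgt.
  rewrite -(integral_heat_kernel x h0); apply: ge0_le_integral => //.
  - by apply/measurable_EFinP.
  - by move=> y _; rewrite lee_fin ler_piMr ?heat_kernel_ge0 ?annulus_weight_le1.
rewrite indicE mem_set// mulr1.
have [c cr <-] := annulus_weight_touch r0 rM xM.
set K := (M - r) ^- 2; have K0 : 0 <= K by rewrite invr_ge0 sqr_ge0.
apply: (@le_trans _ _ (K%:E * \int[mu]_y
    (heat_kernel h (vsub x y) * enorm (vsub y c) ^+ 2)%:E)%E).
  have mq : measurable_fun setT (fun y => (heat_kernel h (vsub x y) * enorm (vsub y c) ^+ 2)%:E).
    apply/measurable_EFinP; apply: measurable_funM => //; apply: measurable_funX.
    apply: (measurableT_comp (@measurable_enorm R n)); exact: measurable_vsub.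
  have q0 y : (0 <= (heat_kernel h (vsub x y) * enorm (vsub y c) ^+ 2)%:E)%E.
    by rewrite lee_fin; apply: mulr_ge0; [exact: heat_kernel_ge0|exact: sqr_ge0].
  rewrite -ge0_integralZl//.
  apply: ge0_le_integral => //.
  - exact: measurable_funeM.
  - move=> y _; rewrite -EFinM lee_fin mulrCA ler_wpM2l ?heat_kernel_ge0//.
    exact: annulus_weight_le.
apply: le_trans (lee_wpmul2l _ (heat_kernel_moment x c h0)) _; first by rewrite lee_fin.
by rewrite -EFinM ?lee_fin /K; rewrite le_eqVlt; apply/orP; left; apply/eqP; ring.
Qed.

End weight.

(** * From time-step inequalities to time integrals *)

Section time_steps.
Context {R : realType}.
Implicit Types (t h b T K : R).
Local Notation leb := (@lebesgue_measure R).

Lemma ge0_integral_time_shift h b (F : R -> \bar R) :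
  measurable_fun [set: R] F -> (forall t, 0 <= F t)%E ->
  (\int[leb]_(t in `]h, (b + h)%R]) F t = \int[leb]_(t in `]0%R, b]) F (t + h)%R)%E.
Proof.
move=> mF F0; rewrite integral_mkcond [RHS]integral_mkcond.
have mFi : measurable_fun [set: R] (F \_ `]h, (b + h)%R]%classic).
  by apply/(measurable_restrictT _ _).1 => //; exact: measurable_funTS.
rewrite (@ge0_integral_affine _ 1 h)// ?mul1e; last first.
  by move=> x; exact: erestrict_ge0.
apply: eq_integral => x _; rewrite mul1r !patchE; congr (if _ then _ else _).
by rewrite !mem_setE !in_itv/= ltrDr lerD2r.
Qed.

Variables (F g : R -> \bar R) (K E0 : R).
Hypotheses (mF : measurable_fun [set: R] F) (mg : measurable_fun [set: R] g).
Hypotheses (F0 : forall t, (0 <= F t)%E) (g0 : forall t, (0 <= g t)%E).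
Hypotheses (K0 : 0 < K) (E00 : 0 <= E0).
Hypothesis step : forall h t, 0 < h -> 0 < t ->
  (F (h + t) <= F t + (K * h)%:E * g t)%E.
Hypothesis start : forall h, 0 < h -> (F h <= (K * h * E0)%:E)%E.

Let mitv b : measurable (`]0%R, b]%classic : set (measurableTypeR R)).
Proof. exact: measurable_itv. Qed.

(** Splitting at [h] and translating the second piece back by [h] allows the
    step inequality to be applied pointwise in time. *)
Let one_step h b (G : \bar R) : 0 < h -> 0 <= b ->
  (\int[leb]_(t in `]0%R, b]) g t <= G)%E ->
  (\int[leb]_(t in `]0%R, (b + h)%R]) F t <=
   (K * h)%:E * ((h * E0)%:E + G) + \int[leb]_(t in `]0%R, b]) F t)%E.
Proof.
move=> h0 b0 gG.
have G0 : (0 <= G)%E by apply: le_trans gG; exact: integral_ge0.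
have Kh0 : 0 <= K * h by rewrite mulr_ge0// ltW.
rewrite (@itv_bndbnd_setU _ _ _ (BRight h) _); last 2 first.
- by rewrite bnd_simp ltW.
- by rewrite bnd_simp lerDr.
rewrite ge0_integral_setU//; last 2 first.
- exact: measurable_funTS.
- rewrite disj_set2E; apply/eqP/seteqP; split => // x [] /=.
  by rewrite !in_itv/= => /andP[_ xh] /andP[hx _]; lra.
rewrite ge0_integral_time_shift// ge0_muleDr ?lee_fin ?mulr_ge0 ?(ltW h0)//.
rewrite -[leRHS]addeA; apply: leeD.
  apply: (@le_trans _ _ (\int[leb]_(t in `]0%R, h]) (cst (K * h * E0)%:E t))%E).
    apply: ge0_le_integral => //.
    - exact: measurable_funTS.
    - move=> t; rewrite /= in_itv/= => /andP[t0 th].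
      apply: le_trans (start t0) _; rewrite lee_fin ler_wpM2r// ler_wpM2l// ltW//.
  rewrite integral_cst//= lebesgue_measure_itv/= lte_fin h0 oppr0 adde0.
  by rewrite -!EFinM lee_fin le_eqVlt; apply/orP; left; apply/eqP; ring.
have mFh : measurable_fun [set: R] (fun t => F (t + h)).
  by apply: (measurableT_comp mF); exact: measurable_funD.
apply: (@le_trans _ _ (\int[leb]_(t in `]0%R, b]) (F t + (K * h)%:E * g t))%E).
  apply: ge0_le_integral => //.
  - exact: measurable_funTS.
  - by apply: emeasurable_funD; [|apply: measurable_funeM]; exact: measurable_funTS.
  - move=> t; rewrite /= in_itv/= => /andP[t0 _].
    by rewrite addrC; exact: step.
rewrite ge0_integralD//; last 3 first.
- exact: measurable_funTS.
- by move=> t _; rewrite mule_ge0.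
- by apply: measurable_funeM; exact: measurable_funTS.
rewrite ge0_integralZl//; last exact: measurable_funTS.
by rewrite addeC leeD2r// lee_wpmul2l.
Qed.

(** The integral of [F] over the first [k] steps grows by at most
    [K * h * (h * E0 + G)] at each step, [G] being the integral of [g]. After [N]
    steps of length [h = T / N] this adds up to [K * T * (h * E0 + G)], and
    [h * E0] tends to [0]. *)
Lemma integral_time_steps_le T : 0 < T ->
  (\int[leb]_(t in `]0%R, T[) F t <= (K * T)%:E * \int[leb]_(t in `]0%R, T[) g t)%E.
Proof.
move=> T0; set G := (\int[leb]_(t in `]0%R, T[) g t)%E.
have G0 : (0 <= G)%E by exact: integral_ge0.
have KT0 : 0 < K * T by rewrite mulr_gt0.
have discrete (N k : nat) : (0 < N)%N -> (k <= N)%N ->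
    (\int[leb]_(t in `]0%R, (k%:R * (T / N%:R))%R]) F t <=
     (k%:R * (K * (T / N%:R)))%:E * ((T / N%:R * E0)%:E + G))%E.
  move=> N0; have h0 : 0 < T / N%:R by rewrite divr_gt0// ltr0n.
  elim: k => [_|k IH kN].
    by rewrite !mul0r set_itvoc0 integral_set0 mul0e.
  have -> : k.+1%:R * (T / N%:R) = k%:R * (T / N%:R) + T / N%:R.
    by rewrite -natr1 mulrDl mul1r.
  have b0 : 0 <= k%:R * (T / N%:R) by rewrite mulr_ge0// ltW.
  have gG : (\int[leb]_(t in `]0%R, (k%:R * (T / N%:R))%R]) g t <= G)%E.
    apply: ge0_subset_integral => //; first exact: measurable_funTS.
    move=> t; rewrite /= !in_itv/= => /andP[-> tk]/=.
    apply: le_lt_trans tk _; rewrite mulrA ltr_pdivrMr ?ltr0n//.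
    by rewrite mulrC ltr_pM2l// ltr_nat.
  apply: le_trans (one_step h0 b0 gG) _.
  rewrite -natr1 mulrDl mul1r EFinD ge0_muleDl; last 2 first.
  - by rewrite lee_fin !mulr_ge0// ltW.
  - by rewrite lee_fin mulr_ge0// ltW.
  by rewrite addeC leeD2r// IH// ltnW.
have [Goo|Goo] := eqVneq G +oo%E.
  by rewrite Goo gt0_muley ?leey// lte_fin.
have Gf : G \is a fin_num by rewrite ge0_fin_numE// ltey.
apply/lee_addgt0Pr => e e0.
(* The number of steps is chosen to make the error [K * T * (T / N) * E0] of the
   first steps smaller than [e]. *)
pose N := (Num.trunc (K * T * T * E0 / e)).+1.
have := discrete N N (ltn0Sn _) (leqnn _).
have N0 : 0 < N%:R :> R by rewrite ltr0n.
rewrite [N%:R * (T / _)]mulrC divfK ?gt_eqF//.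
rewrite (_ : N%:R * _ = K * T); last by field; rewrite gt_eqF.
move=> H; apply: (@le_trans _ _ (\int[leb]_(t in `]0%R, T]) F t)%E).
  apply: ge0_subset_integral => //; first exact: measurable_funTS.
  by move=> t; rewrite /= !in_itv/= => /andP[-> /ltW].
apply: le_trans H _.
rewrite -(fineK Gf) -EFinD -!EFinM -?EFinD lee_fin mulrDr addrC lerD2l.
have := truncnS_gt (K * T * T * E0 / e); rewrite -/N ltr_pdivrMr// => HN.
rewrite (_ : K * T * (T / N%:R * E0) = (K * T * T * E0) / N%:R); last by ring.
by rewrite ler_pdivrMr// [leRHS]mulrC ltW.
Qed.

End time_steps.

(** * Weighted energies of data supported in a ball *)

Section energy.
Context {R : realType} {n : nat}.
Implicit Types (t h r M T : R) (x y : n.-tuple R) (w f : n.-tuple R -> R).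
Local Notation leb := (@lebesgue_measure R).
Local Notation mu := (lebesgue_n R n).

Definition heat_energy w f t : \bar R :=
  (\int[mu]_x (w x * heat_solution f t x ^+ 2)%:E)%E.

Lemma heat_energy_ge0 w f t : (forall x, 0 <= w x) -> (0 <= heat_energy w f t)%E.
Proof. by move=> w0; apply: integral_ge0 => x _; rewrite lee_fin mulr_ge0 ?sqr_ge0. Qed.

Lemma measurable_heat_energy w f : measurable_fun setT w -> (forall x, 0 <= w x) ->
  measurable_fun setT f -> measurable_fun [set: R] (heat_energy w f).
Proof.
move=> mw w0 mf.
apply: (measurable_fun_fubini_tonelli_F
  (fun p : measurableTypeR R * n.-tuple R => (w p.2 * heat_solution f p.1 p.2 ^+ 2)%:E)).
  apply/measurable_EFinP; apply: measurable_funM; first exact: measurableT_comp.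
  by apply: measurable_funX; exact: measurable_heat_solution.
by move=> p; rewrite lee_fin mulr_ge0 ?sqr_ge0.
Qed.

Lemma heat_energyD w w' f t : measurable_fun setT f ->
  measurable_fun setT w -> (forall x, 0 <= w x) ->
  measurable_fun setT w' -> (forall x, 0 <= w' x) ->
  heat_energy (w \+ w') f t = (heat_energy w f t + heat_energy w' f t)%E.
Proof.
move=> mf mw w0 mw' w0'; have ms := measurable_heat_solution_at t mf.
rewrite /heat_energy -ge0_integralD//.
- by apply: eq_integral => x _; rewrite -EFinD mulrDl.
- by move=> x _; rewrite lee_fin mulr_ge0 ?sqr_ge0.
- by apply/measurable_EFinP; apply: measurable_funM => //; exact: measurable_funX.
- by move=> x _; rewrite lee_fin mulr_ge0 ?sqr_ge0.
- by apply/measurable_EFinP; apply: measurable_funM => //; exact: measurable_funX.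
Qed.

Lemma heat_energy_indic (A : set (n.-tuple R)) f t :
  heat_energy \1_A f t = (\int[mu]_(x in A) (`|heat_solution f t x| ^+ 2)%:E)%E.
Proof.
rewrite [RHS]integral_mkcond; apply: eq_integral => x _.
rewrite patchE indicE real_normK ?num_real//.
by case: (x \in A); rewrite ?mul1r ?mul0r.
Qed.

Variable f : n.-tuple R -> R.
Hypotheses (mf : measurable_fun setT f) (fi : heat_integrable f).

Lemma heat_energy_nonincreasing t T : 0 < t -> t < T ->
  (heat_energy (cst 1%R) f T <= heat_energy (cst 1%R) f t)%E.
Proof.
move=> t0 tT; have h0 : 0 < T - t by rewrite subr_gt0.
have TE x : heat_solution f T x = heat_solution (heat_solution f t) (T - t) x.
  by rewrite -heat_solution_semigroup// subrK.
rewrite /heat_energy; under eq_integral do rewrite TE.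
apply: heat_solution_weight_le => //.
- exact: measurable_heat_solution_at.
- exact: heat_integrable_solution.
- by move=> y; under eq_integral do rewrite mulr1; rewrite integral_heat_kernel.
Qed.

Variables (r M : R).
Hypotheses (r0 : 0 < r) (rM : r < M).
Let w := @annulus_weight R n r M.
Let B : set (n.-tuple R) := eball n M.
Let K := 12 * n%:R / (M - r) ^+ 2.

Let mw : measurable_fun setT w. Proof. exact: measurable_annulus_weight. Qed.
Let w0 x : 0 <= w x. Proof. exact: annulus_weight_ge0. Qed.
Let mB : measurable_fun setT (\1_B : _ -> R).
Proof. by apply: measurable_indic; exact: measurable_eball. Qed.
Let K0 : 0 <= K.
Proof. by rewrite divr_ge0 ?sqr_ge0// mulr_ge0. Qed.

(** [heat_solution_weight_le] applied to the pointwise bound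
    [heat_annulus_weight_le] on the image of the weight. *)
Let step_le (v : n.-tuple R -> R) h : measurable_fun setT v -> heat_integrable v ->
  0 < h -> (heat_energy w v h <=
    \int[mu]_x (w x * v x ^+ 2)%:E + (K * h)%:E * \int[mu]_x (\1_B x * v x ^+ 2)%:E)%E.
Proof.
move=> mv vi h0.
have Kh0 : 0 <= K * h by rewrite mulr_ge0// ltW.
rewrite -ge0_integralZl//; last 2 first.
- by apply/measurable_EFinP; apply: measurable_funM => //; exact: measurable_funX.
- by move=> x _; rewrite lee_fin mulr_ge0 ?sqr_ge0.
rewrite -ge0_integralD//; last 4 first.
- by move=> x _; rewrite lee_fin mulr_ge0 ?sqr_ge0.
- by apply/measurable_EFinP; apply: measurable_funM => //; exact: measurable_funX.
- by move=> x _; rewrite mule_ge0// lee_fin mulr_ge0 ?sqr_ge0.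
- apply: measurable_funeM.
  by apply/measurable_EFinP; apply: measurable_funM => //; exact: measurable_funX.
have E x : ((w x * v x ^+ 2)%:E + (K * h)%:E * (\1_B x * v x ^+ 2)%:E =
    ((w x + K * h * \1_B x) * v x ^+ 2)%:E)%E.
  by rewrite -EFinM -EFinD; congr (_%:E); ring.
under [leRHS]eq_integral do rewrite E.
apply: heat_solution_weight_le => //.
- by apply: measurable_funD => //; exact: measurable_funM.
- by move=> y; exact: heat_annulus_weight_le.
Qed.

Lemma heat_energy_step h t : 0 < h -> 0 < t ->
  (heat_energy w f (h + t) <= heat_energy w f t + (K * h)%:E * heat_energy \1_B f t)%E.
Proof.
move=> h0 t0; rewrite {1}/heat_energy.
under eq_integral do rewrite heat_solution_semigroup//.
apply: step_le => //.
- exact: measurable_heat_solution_at.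
- exact: heat_integrable_solution.
Qed.

Hypothesis f2i : mu.-integrable setT (fun x => (f x ^+ 2)%:E).
Hypothesis fr : forall x, f x != 0 -> enorm x < r.

Let mf2 : measurable_fun setT (fun x => (f x ^+ 2)%:E).
Proof. exact: measurable_int f2i. Qed.

Let f2_fin : (\int[mu]_x (f x ^+ 2)%:E)%E \is a fin_num.
Proof. exact: integrable_fin_num. Qed.

(** The weight vanishes on the support of the datum, so only the error term of
    the first step is left. *)
Lemma heat_energy_start h : 0 < h ->
  (heat_energy w f h <= (K * h * fine (\int[mu]_x (f x ^+ 2)%:E))%:E)%E.
Proof.
move=> h0; have Kh0 : 0 <= K * h by rewrite mulr_ge0// ltW.
apply: le_trans (step_le mf fi h0) _.
rewrite integral0_eq ?add0e => [|x _]; last first.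
  have [->|/fr/ltW xr] := eqVneq (f x) 0; first by rewrite expr0n mulr0.
  by rewrite /w annulus_weight_in// mul0r.
rewrite [leRHS]EFinM fineK// lee_wpmul2l ?lee_fin//; apply: ge0_le_integral => //.
- by move=> x _; rewrite lee_fin mulr_ge0 ?sqr_ge0.
- by apply/measurable_EFinP; apply: measurable_funM => //; exact: measurable_funX.
- by move=> x _; rewrite lee_fin ler_piMl ?sqr_ge0// indicE lern1 leq_b1.
Qed.

(** Monotonicity bounds [T * E_1 T] by the time integral of [E_1], and
    [1 <= w + 1_B] splits the latter into an observed part and a weighted part. *)
Lemma heat_energy_le_time_integral T : 0 < K -> 0 < T ->
  (heat_energy (cst 1%R) f T <=
   (1 / T + K)%:E * \int[leb]_(t in `]0%R, T[) heat_energy \1_B f t)%E.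
Proof.
move=> Kp T0; set G := (\int[leb]_(t in _) _)%E.
have mFw := measurable_heat_energy mw w0 mf.
have mFB := measurable_heat_energy mB (fun=> ler0n _ _) mf.
have m1 : measurable_fun [set: R] (heat_energy (cst 1%R) f).
  by apply: measurable_heat_energy => // x; exact: ler01.
have G0 : (0 <= G)%E by apply: integral_ge0 => t _; exact: heat_energy_ge0.
have Ti0 : 0 <= T^-1 by rewrite invr_ge0 ltW.
have wG : (\int[leb]_(t in `]0%R, T[) heat_energy w f t <= (K * T)%:E * G)%E.
  apply: (integral_time_steps_le (E0 := fine (\int[mu]_x (f x ^+ 2)%:E)%E)) => //.
  - by move=> t; exact: heat_energy_ge0.
  - by move=> t; exact: heat_energy_ge0.
  - by apply/fine_ge0/integral_ge0 => x _; rewrite lee_fin sqr_ge0.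
  - exact: heat_energy_step.
  - exact: heat_energy_start.
have TE : (T%:E * heat_energy (cst 1%R) f T <= G + (K * T)%:E * G)%E.
  apply: (@le_trans _ _ (\int[leb]_(t in `]0%R, T[) (cst (heat_energy (cst 1%R) f T) t))%E).
    by rewrite integral_cst//= lebesgue_measure_itv/= lte_fin T0 oppr0 adde0 muleC.
  apply: (@le_trans _ _ (\int[leb]_(t in `]0%R, T[)
      (heat_energy \1_B f t + heat_energy w f t))%E).
    apply: ge0_le_integral; first exact: measurable_itv.
    - by move=> t _; exact: heat_energy_ge0.
    - exact: measurable_cst.
    - by apply: emeasurable_funD; exact: measurable_funTS.
    - move=> t; rewrite /= in_itv/= => /andP[t0 tT].
      apply: le_trans (heat_energy_nonincreasing t0 tT) _.
      have ms := measurable_heat_solution_at t mf.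
      rewrite -heat_energyD//; apply: ge0_le_integral => //.
      + by move=> x _; rewrite lee_fin mulr_ge0 ?sqr_ge0.
      + by apply/measurable_EFinP; apply: measurable_funM => //; exact: measurable_funX.
      + apply/measurable_EFinP; apply: measurable_funM; first exact: measurable_funD.
        exact: measurable_funX.
      + move=> x _; rewrite lee_fin ler_wpM2r ?sqr_ge0//= indicE.
        have [|] := boolP (x \in B); first by rewrite lerDl.
        move=> xB; rewrite /w annulus_weight_out// ?add0r// leNgt.
        by apply: contraNN xB => xM; rewrite inE.
  rewrite ge0_integralD//; last 4 first.
  - by move=> t _; exact: heat_energy_ge0.
  - exact: measurable_funTS.
  - by move=> t _; exact: heat_energy_ge0.
  - exact: measurable_funTS.
  by apply: leeD => //; exact: lexx.
have := lee_wpmul2l (_ : (0 <= T^-1%:E)%E) TE.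
rewrite muleA -EFinM mulVf ?gt_eqF// mul1e lee_fin => /(_ Ti0) /le_trans; apply.
rewrite -[X in (X + _)%E]mul1e -ge0_muleDl ?lee_fin ?(mulr_ge0 (ltW Kp) (ltW T0))//.
rewrite muleA -EFinD -EFinM (_ : T^-1 * _ = 1 / T + K)//.
by field; rewrite gt_eqF.
Qed.

End energy.

(** * Scaling and positivity of ball volumes *)

Section volume.
Context {R : realType}.
Implicit Types (n : nat) (a r : R).

Definition vscale n a (x : n.-tuple R) : n.-tuple R := [tuple a * tnth x i | i < n].

Lemma measurable_vscale n a : measurable_fun setT (@vscale n a).
Proof.
apply/measurable_fun_tnthP => i.
rewrite (_ : _ \o _ = fun x : n.-tuple R => a * tnth x i); last first.
  by apply/funext => x /=; rewrite tnth_mktuple.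
by apply: measurable_funM => //; exact: measurable_tnth.
Qed.

Lemma vscale_cons n a s (x : n.-tuple R) :
  vscale a (tuple_cons (s, x)) = tuple_cons (a * s, vscale a x).
Proof.
apply: eq_from_tnth => i; rewrite tnth_mktuple.
by have [j ->|->] := unliftP ord0 i; rewrite ?tnthS ?tnth0 ?tnth_mktuple.
Qed.

Lemma ge0_integral_vscale n a (f : n.-tuple R -> \bar R) : 0 < a ->
  measurable_fun [set: n.-tuple R] f -> (forall x, 0 <= f x)%E ->
  (\int[lebesgue_n R n]_x f x = (a ^+ n)%:E * \int[lebesgue_n R n]_x f (vscale a x))%E.
Proof.
move=> a0; elim: n f => [|n IH] f mf f0.
  rewrite expr0 mul1e; apply: eq_integral => x _; congr f.
  by rewrite [RHS]tuple0 [LHS]tuple0.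
have an0 : 0 <= a ^+ n by rewrite exprn_ge0// ltW.
rewrite ge0_integral_lebesgue_cons//.
rewrite (@ge0_integral_lebesgue_cons _ n (f \o vscale a)); last 2 first.
- exact: (measurableT_comp mf (@measurable_vscale _ a)).
- by move=> x; exact: f0.
have mfc : measurable_fun setT (f \o @tuple_cons R n).
  by apply: measurableT_comp => //; exact: measurable_tuple_cons.
have mfs s : measurable_fun setT (fun x : n.-tuple R => f (tuple_cons (s, x))).
  exact: (measurableT_comp mfc (pair1_measurable (s : measurableTypeR R))).
under eq_integral do rewrite IH//.
have mI : measurable_fun [set: R]
    (fun s => \int[lebesgue_n R n]_x f (tuple_cons (s, vscale a x)))%E.
  apply: (measurable_fun_fubini_tonelli_F
    (fun p : measurableTypeR R * n.-tuple R => f (tuple_cons (p.1, vscale a p.2)))) => //.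
  apply: (measurableT_comp mfc); apply: measurable_fun_pair => //.
  by apply: measurableT_comp => //; exact: measurable_vscale.
rewrite ge0_integralZl//; last by move=> s _; exact: integral_ge0.
rewrite (@ge0_integral_affine _ a 0 _ a0 mI); last by move=> s; exact: integral_ge0.
rewrite muleA -EFinM -exprSr; congr (_ * _)%E.
apply: eq_integral => s _; apply: eq_integral => x _.
by rewrite addr0 /= vscale_cons.
Qed.

Lemma enorm_vscale n a (x : n.-tuple R) : 0 <= a -> enorm (vscale a x) = a * enorm x.
Proof.
move=> a0; rewrite /enorm; under eq_bigr do rewrite tnth_mktuple exprMn.
by rewrite -mulr_sumr sqrtrM ?sqr_ge0// sqrtr_sqr ger0_norm.
Qed.

Lemma lebesgue_n_eball n r : 0 < r ->
  (lebesgue_n R n (eball n r) = (r ^+ n)%:E * lebesgue_n R n (eball n 1))%E.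
Proof.
move=> r0; have mB s := @measurable_eball R n s.
have IE s : (lebesgue_n R n (eball n s) = \int[lebesgue_n R n]_x (\1_(eball n s) x)%:E)%E.
  by rewrite integral_indic// setIT.
rewrite !IE (ge0_integral_vscale r0).
- congr (_ * _)%E; apply: eq_integral => x _; congr (_%:E).
  rewrite !indicE; congr (nat_of_bool _)%:R.
  apply/idP/idP; rewrite !inE /eball/= enorm_vscale ?ltW//.
    by rewrite -[ltRHS]mulr1 ltr_pM2l.
  by move=> x1; rewrite -[ltRHS]mulr1 ltr_pM2l.
- by apply/measurable_EFinP; exact: measurable_indic.
- by move=> x; rewrite lee_fin.
Qed.

Definition cube n r : set (n.-tuple R) := [set x | forall i, `[- r, r]%classic (tnth x i)].
Arguments cube : clear implicits.

Lemma measurable_cube n r : measurable (cube n r).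
Proof.
rewrite (_ : cube n r = \bigcap_(i in [set: 'I_n])
    ((fun x : n.-tuple R => tnth x i) @^-1` `[- r, r]%classic)); last first.
  by apply/seteqP; split=> x /= H i => [_|]; [exact: H|exact: (H i I)].
apply: fin_bigcap_measurable => // i _.
by rewrite -[X in measurable X]setTI; apply: measurable_tnth.
Qed.

Lemma lebesgue_n_cube n r : 0 < r ->
  (lebesgue_n R n (cube n r) = ((2 * r) ^+ n)%:E)%E.
Proof.
move=> r0; rewrite (@lebesgue_n_box R n (fun=> `[- r, r]%classic)).
  rewrite (eq_bigr (fun=> (2 * r)%:E)) => [|i _].
    by rewrite prodEFin prodr_const card_ord.
  rewrite lebesgue_measure_itv/= lte_fin ifT; last by lra.
  by rewrite -EFinD; congr (_%:E); ring.
by move=> i; exact: measurable_itv.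
Qed.

Lemma lebesgue_n_eball_fin n : lebesgue_n R n (eball n 1) \is a fin_num.
Proof.
rewrite ge0_fin_numE//.
apply: (@le_lt_trans _ _ (lebesgue_n R n (cube n 1))).
  apply: le_measure; rewrite ?inE; [exact: measurable_eball|exact: measurable_cube|].
  move=> x x1 i /=; rewrite in_itv/= -ler_norml.
  by apply: le_trans (tnth_le_enorm x i) (ltW x1).
by rewrite lebesgue_n_cube// ltry.
Qed.

(** The ball contains the cube of half-side [(n + 1)^-1], because
    [n * (n + 1)^-2 < 1]. *)
Lemma unit_ball_volume_gt0 n : 0 < unit_ball_volume R n.
Proof.
pose r : R := n.+1%:R^-1; have r0 : 0 < r by rewrite invr_gt0 ltr0n.
rewrite -lte_fin /unit_ball_volume fineK ?lebesgue_n_eball_fin//.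
apply: (@lt_le_trans _ _ (lebesgue_n R n (cube n r))).
  by rewrite lebesgue_n_cube// lte_fin exprn_gt0// mulr_gt0.
apply: le_measure; rewrite ?inE; [exact: measurable_cube|exact: measurable_eball|].
move=> x xr; rewrite /eball/= -ltr_sqr ?nnegrE ?enorm_ge0// enorm_sqr.
apply: (@le_lt_trans _ _ (\sum_(i < n) r ^+ 2)).
  apply: ler_sum => i _; rewrite -[leLHS]real_normK ?num_real//.
  rewrite ler_sqr ?nnegrE ?(ltW r0)// ler_norml.
  by have := xr i; rewrite /= in_itv.
rewrite sumr_const card_ord expr1n -mulr_natr expr2 -mulrA.
have r1 : r <= 1 by rewrite invf_le1 ?ler1n ?ltr0n.
have rn : r * n%:R < 1 by rewrite mulrC ltr_pdivrMr ?ltr0n// mul1r ltr_nat.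
by apply: le_lt_trans rn; rewrite ler_piMl// mulr_ge0// ltW.
Qed.

End volume.

(** * Nonnegative data *)

Section nonneg_data.
Context {R : realType} {n : nat}.
Implicit Types (t r T : R) (x y : n.-tuple R).
Local Notation mu := (lebesgue_n R n).

Variable f : n.-tuple R -> R.
Hypotheses (f0 : forall x, 0 <= f x) (fi : mu.-integrable setT (EFin \o f)).

Let m := \int[mu]_x f x.

Let mf : measurable_fun setT f.
Proof. by apply/measurable_EFinP; exact: measurable_int fi. Qed.
Let fhi : heat_integrable f.
Proof. exact: integrable_heat_integrable. Qed.
Let mE : (m%:E = \int[mu]_x (f x)%:E)%E.
Proof. by rewrite /m /Rintegral fineK// integrable_fin_num. Qed.

Lemma heat_solution_ge0 t x : 0 <= heat_solution f t x.
Proof.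
by apply: Rintegral_ge0 => // y _; rewrite mulr_ge0// heat_kernel_ge0.
Qed.

Lemma heat_solution_le_mass t x : 0 < t ->
  heat_solution f t x <= (4 * pi * t) `^ (- (n%:R / 2)) * m.
Proof.
move=> t0; rewrite -lee_fin heat_solutionE// EFinM mE.
rewrite -ge0_integralZl ?lee_fin ?powR_ge0//; last 2 first.
- exact/measurable_EFinP.
- by move=> y _; rewrite lee_fin.
apply: ge0_le_integral => //.
- by move=> y _; rewrite lee_fin mulr_ge0// heat_kernel_ge0.
- apply/measurable_EFinP; apply: measurable_funM => //; exact: measurable_heat_kernell.
- by apply: measurable_funeM; exact/measurable_EFinP.
- by move=> y _; rewrite -EFinM lee_fin ler_wpM2r// heat_kernel_le.
Qed.

(** Writing one factor of [u T ^+ 2] as an integral against the datum and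
    exchanging integrals, the heat operator acts on [u T] and gives [u (2 T)]. *)
Lemma heat_energy_le_mass T : 0 < T ->
  (heat_energy (cst 1%R) f T <= ((8 * pi * T) `^ (- (n%:R / 2)) * m ^+ 2)%:E)%E.
Proof.
move=> T0; set u := heat_solution f T.
have u0 x : 0 <= u x by exact: heat_solution_ge0.
have mu' : measurable_fun setT u by exact: measurable_heat_solution_at.
have ui : heat_integrable u by exact: heat_integrable_solution.
have TT0 : 0 < T + T by rewrite addr_gt0.
have m0 : 0 <= m by exact: Rintegral_ge0.
pose F (p : n.-tuple R * n.-tuple R) : \bar R :=
  (u p.1 * (heat_kernel T (vsub p.1 p.2) * f p.2))%:E.
have F0 p : (0 <= F p)%E.
  rewrite lee_fin; apply: mulr_ge0; first exact: u0.
  by apply: mulr_ge0; [exact: heat_kernel_ge0|exact: f0].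
have mF : measurable_fun setT F.
  apply/measurable_EFinP; apply: measurable_funM; first exact: measurableT_comp.
  apply: measurable_funM; first exact: measurable_heat_kernelB.
  exact: measurableT_comp.
have -> : heat_energy (cst 1%R) f T = (\int[mu]_x \int[mu]_y F (x, y))%E.
  apply: eq_integral => x _; rewrite mul1r expr2 EFinM.
  rewrite [X in (_ * X)%E](heat_solutionE _ fhi T0).
  rewrite -ge0_integralZl//.
  - by apply/measurable_EFinP; apply: measurable_funM => //; exact: measurable_heat_kernell.
  - by move=> y _; rewrite lee_fin mulr_ge0 ?heat_kernel_ge0.
  - by rewrite lee_fin.
rewrite fubini_tonelli//.
have FE y : (\int[mu]_x F (x, y) = (f y * heat_solution f (T + T) y)%:E)%E.
  rewrite heat_solution_semigroup// EFinM heat_solutionE// -ge0_integralZl//.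
  - apply: eq_integral => x _; rewrite /F/= heat_kernelBC -EFinM; congr (_%:E).
    by rewrite -/u; ring.
  - by apply/measurable_EFinP; apply: measurable_funM => //; exact: measurable_heat_kernell.
  - by move=> x _; rewrite lee_fin mulr_ge0 ?heat_kernel_ge0.
  - by rewrite lee_fin.
under eq_integral do rewrite FE.
apply: (@le_trans _ _ (\int[mu]_y (((8 * pi * T) `^ (- (n%:R / 2)) * m)%:E * (f y)%:E))%E).
  apply: ge0_le_integral => //.
  - by move=> y _; rewrite lee_fin mulr_ge0// heat_solution_ge0.
  - by apply/measurable_EFinP; apply: measurable_funM => //; exact: measurable_heat_solution_at.
  - by apply: measurable_funeM; exact/measurable_EFinP.
  - move=> y _; rewrite -EFinM lee_fin [leRHS]mulrC ler_wpM2l//.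
    rewrite (_ : 8 * pi * T = 4 * pi * (T + T)); last by ring.
    exact: heat_solution_le_mass.
rewrite ge0_integralZl//; last 3 first.
- exact/measurable_EFinP.
- by move=> y _; rewrite lee_fin.
- by rewrite lee_fin mulr_ge0// powR_ge0.
by rewrite -mE -EFinM lee_fin expr2 mulrA.
Qed.

(** Two points of the ball satisfy [|x - y|^2 <= 4 r^2], so for [T / 2 < t <= T]
    the Gaussian exponent is at least [- r^2 / t >= - 2 r^2 / T]. *)
Lemma heat_solution_ge_local_mass t T r x : 0 < r -> 0 < T -> T / 2 < t -> t <= T ->
  enorm x < r ->
  (4 * pi * T) `^ (- (n%:R / 2)) * expR (- (2 * r ^+ 2 / T)) *
    \int[mu]_(y in eball n r) f y <= heat_solution f t x.
Proof.
move=> r0 T0 Tt tT xr; have t0 : 0 < t by lra.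
set c := _ * expR _; have c0 : 0 <= c by rewrite mulr_ge0 ?powR_ge0 ?expR_ge0.
have mB := @measurable_eball R n r.
have fiB : mu.-integrable (eball n r) (EFin \o f).
  by apply: integrableS fi.
rewrite -lee_fin heat_solutionE// EFinM /Rintegral fineK; last exact: integrable_fin_num.
apply: (@le_trans _ _ (\int[mu]_(y in eball n r)
    (heat_kernel t (vsub x y) * f y)%:E)%E); last first.
  apply: ge0_subset_integral => //.
  - by apply/measurable_EFinP; apply: measurable_funM => //; exact: measurable_heat_kernell.
  - by move=> y _; rewrite lee_fin mulr_ge0// heat_kernel_ge0.
rewrite -ge0_integralZl//; last 2 first.
- by apply/measurable_EFinP; exact: measurable_funTS.
- by move=> y _; rewrite lee_fin.
apply: ge0_le_integral => //.
- by move=> y _; rewrite mule_ge0// lee_fin.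
- by apply: measurable_funeM; apply/measurable_EFinP; exact: measurable_funTS.
- apply/measurable_EFinP; apply: measurable_funTS; apply: measurable_funM => //.
  exact: measurable_heat_kernell.
- move=> y yr; rewrite -EFinM lee_fin ler_wpM2r// /c /heat_kernel.
  apply: ler_pM; rewrite ?powR_ge0 ?expR_ge0//.
    have pp (s : R) : 0 < s -> 0 < 4 * pi * s.
      by move=> s0; rewrite !mulr_gt0// pi_gt0.
    rewrite !powRN lef_pV2 ?posrE ?powR_gt0 ?pp//.
    have t4 := ltW (pp _ t0); have T4 := ltW (pp _ T0).
    apply: ge0_ler_powR; rewrite ?nnegrE ?divr_ge0//.
    by rewrite ler_pM2l// mulr_gt0// pi_gt0.
  rewrite ler_expR lerN2.
  have xy : enorm (vsub x y) ^+ 2 <= 4 * r ^+ 2.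
    apply: (@le_trans _ _ (2 * enorm x ^+ 2 + 2 * enorm y ^+ 2)).
      rewrite !enorm_sqr !mulr_sumr -big_split/=; apply: ler_sum => i _.
      rewrite tnth_mktuple; have := sqr_ge0 (tnth x i + tnth y i); nra.
    have := enorm_ge0 x; have := enorm_ge0 y; move: yr; rewrite /eball/=; nra.
  rewrite ler_pdivrMr ?mulr_gt0// mulrAC ler_pdivlMr//.
  have := sqr_ge0 r; nra.
Qed.

End nonneg_data.

(** * The two observation estimates *)

(** The upper bound of [heat_energy_le_mass] is the constant of the theorem times
    the lower bound obtained by integrating the square of
    [heat_solution_ge_local_mass] over half of the time interval and over a ball of
    radius [rho]. *)
Lemma nonneg_constantE (R : realType) (n : nat) (T r V rho mu m : R) :
  0 < T -> 0 < V -> 0 < rho -> 0 < mu ->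
  (8 * pi * T) `^ (- (n%:R / 2)) * m ^+ 2 =
  2 `^ (n%:R / 2 + 1) * pi `^ (n%:R / 2) * T `^ (n%:R / 2 - 1) /
    (V * rho ^+ n * mu ^+ 2) * expR (4 * r ^+ 2 / T) *
  (T / 2 * (rho ^+ n * V *
    ((4 * pi * T) `^ (- (n%:R / 2)) * expR (- (2 * r ^+ 2 / T)) * (mu * m)) ^+ 2)).
Proof.
move=> T0 V0 rho0 mu0; set p : R := n%:R / 2.
have pi0 : 0 < pi :> R := pi_gt0 R.
have E8 : (8 * pi * T) `^ p = 2 `^ p * 2 `^ p * 2 `^ p * pi `^ p * T `^ p.
  by rewrite -!powRM ?mulr_ge0 ?(ltW pi0) ?(ltW T0)//; congr (_ `^ _); ring.
have E4 : (4 * pi * T) `^ p = 2 `^ p * 2 `^ p * pi `^ p * T `^ p.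
  by rewrite -!powRM ?mulr_ge0 ?(ltW pi0) ?(ltW T0)//; congr (_ `^ _); ring.
rewrite !powRN E8 E4.
rewrite (@powRD _ 2 p 1); last by rewrite pnatr_eq0 implybT.
rewrite (@powRD _ T p (-1)); last by rewrite (gt_eqF T0) implybT.
rewrite powRr1// powR_inv1 ?ltW//.
have -> : expR (4 * r ^+ 2 / T) = expR (2 * r ^+ 2 / T) ^+ 2.
  by rewrite [RHS]expr2 -expRD; congr expR; field; rewrite gt_eqF.
rewrite expRN.
field.
by rewrite !gt_eqF ?powR_gt0 ?expR_gt0 ?exprn_gt0.
Qed.

Theorem theorem3p3 (R : realType) :
  (exists C : R, 0 < C /\
    forall (n : nat) (T M r : R) (u0 : n.-tuple R -> R),
      (0 < n)%N -> 0 < T -> 0 < r -> r < M ->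
      u0 \in Lfun (lebesgue_n R n) 2%:E ->
      nonvanishing u0 `<=` eball n r ->
      (\int[lebesgue_n R n]_x (`|heat_solution u0 T x| ^+ 2)%:E <=
       (1 / T + C * n%:R / (M - r) ^+ 2)%:E *
       \int[lebesgue_measure]_(t in `]0%R, T[)
         \int[lebesgue_n R n]_(x in eball n M)
           (`|heat_solution u0 t x| ^+ 2)%:E)%E) /\
  (forall (n : nat) (u0 : n.-tuple R -> R) (r mu : R),
      (0 < n)%N ->
      u0 \in Lfun (lebesgue_n R n) 1%:E ->
      (forall x, 0 <= u0 x) ->
      0 < r -> 0 < mu -> mu < 1 ->
      mu * \int[lebesgue_n R n]_x u0 x <=
        \int[lebesgue_n R n]_(x in eball n r) u0 x ->
      forall T M : R, 0 < T -> 0 < M ->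
      (\int[lebesgue_n R n]_x (`|heat_solution u0 T x| ^+ 2)%:E <=
       (2 `^ (n%:R / 2 + 1) * pi `^ (n%:R / 2) * T `^ (n%:R / 2 - 1) /
          (unit_ball_volume R n * Num.min r M ^+ n * mu ^+ 2) *
        expR (4 * r ^+ 2 / T))%:E *
       \int[lebesgue_measure]_(t in `]0%R, T[)
         \int[lebesgue_n R n]_(x in eball n M)
           (`|heat_solution u0 t x| ^+ 2)%:E)%E).
Proof.
have energyE n (u0 : n.-tuple R -> R) T :
    (\int[lebesgue_n R n]_x (`|heat_solution u0 T x| ^+ 2)%:E =
     heat_energy (cst 1%R) u0 T)%E.
  by apply: eq_integral => x _; rewrite real_normK ?num_real// mul1r.
split.
  exists 12; split => // n T M r u0 n0 T0 r0 rM u2 supp.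
  have f2 := Lfun2_integrable_sqr u2.
  have mf : measurable_fun setT u0.
    by move: u2; rewrite inE => /andP[+ _]; rewrite inE.
  have fi := heat_integrable_sqr mf f2.
  under [X in (_ <= _ * X)%E]eq_integral do rewrite -heat_energy_indic.
  rewrite energyE; apply: (heat_energy_le_time_integral mf fi r0 rM f2) => //.
  by rewrite divr_gt0 ?exprn_gt0 ?subr_gt0// mulr_gt0// ltr0n.
move=> n u0 r mu n0 u1 u0_ge0 r0 mu0 _ local T M T0 M0.
have fi : (lebesgue_n R n).-integrable setT (EFin \o u0) by exact/Lfun1_integrable.
have mf : measurable_fun setT u0 by apply/measurable_EFinP; exact: measurable_int fi.
set V := unit_ball_volume R n; have V0 : 0 < V := unit_ball_volume_gt0 n.
set rho := Num.min r M; have rho0 : 0 < rho by rewrite lt_min r0.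
set m := \int[lebesgue_n R n]_x u0 x in local *.
have m0 : 0 <= m by exact: Rintegral_ge0.
set CC := _ / _ * _.
have CC0 : 0 <= CC.
  by rewrite !mulr_ge0 ?invr_ge0 ?mulr_ge0 ?powR_ge0 ?expR_ge0 ?exprn_ge0
    ?(ltW rho0) ?(ltW V0) ?(ltW mu0).
set c := (4 * pi * T) `^ (- (n%:R / 2)) * expR (- (2 * r ^+ 2 / T)).
have c0 : 0 <= c by rewrite mulr_ge0 ?powR_ge0 ?expR_ge0.
rewrite energyE; apply: le_trans (heat_energy_le_mass u0_ge0 fi T0) _.
rewrite -/m (nonneg_constantE n r m T0 V0 rho0 mu0) -/CC -/c EFinM.
apply: lee_wpmul2l; first by rewrite lee_fin.
have cmm0 : 0 <= c * (mu * m) by rewrite (mulr_ge0 c0)// mulr_ge0// ltW.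
set L := (c * (mu * m)) ^+ 2.
have mBM := @measurable_eball R n M.
have mBr := @measurable_eball R n rho.
(* Only the points of the ball of radius [rho] and the times after [T / 2] are
   kept from the right-hand side. *)
have inner t : T / 2 < t -> t < T ->
    ((rho ^+ n * V * L)%:E <= \int[lebesgue_n R n]_(x in eball n M)
           (`|heat_solution u0 t x| ^+ 2)%:E)%E.
  move=> Tt tT; have ms := measurable_heat_solution_at t mf.
  have msq D : measurable_fun D (fun x => (`|heat_solution u0 t x| ^+ 2)%:E).
    apply/measurable_EFinP; apply: measurable_funTS; apply: measurable_funX.
    exact: measurableT_comp.
  apply: (@le_trans _ _ (\int[lebesgue_n R n]_(x in eball n rho)
           (`|heat_solution u0 t x| ^+ 2)%:E)%E); last first.
    apply: ge0_subset_integral => //.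
    by move=> x; rewrite /eball/= => /lt_le_trans; apply; rewrite ge_min lexx orbT.
  apply: (@le_trans _ _ (\int[lebesgue_n R n]_(x in eball n rho) (cst L%:E) x)%E).
    have VE : (lebesgue_n R n (eball n rho) = (rho ^+ n * V)%:E)%E.
      by rewrite lebesgue_n_eball// EFinM /V /unit_ball_volume fineK// lebesgue_n_eball_fin.
    rewrite integral_cst// [X in (_ <= _ * X)%E](_ : _ = (rho ^+ n * V)%:E)//.
    by rewrite -EFinM lee_fin [leRHS]mulrC.
  apply: ge0_le_integral => //.
  - by move=> x _; rewrite lee_fin sqr_ge0.
  - move=> x xr; rewrite lee_fin ler_sqr ?nnegrE ?normr_ge0 ?cmm0//.
    rewrite ger0_norm ?heat_solution_ge0//.
    apply: (le_trans (ler_wpM2l c0 local)).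
    apply: heat_solution_ge_local_mass => //; first exact: ltW.
    by apply: lt_le_trans xr _; rewrite ge_min lexx.
have mE : measurable_fun [set: R] (fun t => \int[lebesgue_n R n]_(x in eball n M)
           (`|heat_solution u0 t x| ^+ 2)%:E)%E.
  under eq_fun do rewrite -heat_energy_indic.
  by apply: measurable_heat_energy => //; exact: measurable_indic.
apply: (@le_trans _ _ (\int[lebesgue_measure]_(t in `](T / 2)%R, T[)
    (cst (rho ^+ n * V * L)%:E) t)%E).
  rewrite integral_cst//= lebesgue_measure_itv/= lte_fin ifT; last by lra.
  by rewrite -EFinD -EFinM lee_fin le_eqVlt; apply/orP; left; apply/eqP; field.
apply: (@le_trans _ _ (\int[lebesgue_measure]_(t in `](T / 2)%R, T[)
    \int[lebesgue_n R n]_(x in eball n M) (`|heat_solution u0 t x| ^+ 2)%:E)%E).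
  apply: ge0_le_integral; first exact: measurable_itv.
  - by move=> t _; rewrite lee_fin mulr_ge0 ?sqr_ge0// mulr_ge0 ?exprn_ge0
      ?(ltW rho0) ?(ltW V0).
  - exact: measurable_cst.
  - exact: measurable_funTS.
  - by move=> t; rewrite /= in_itv/= => /andP[]; exact: inner.
apply: ge0_subset_integral; first exact: measurable_itv.
- exact: measurable_itv.
- exact: measurable_funTS.
- by move=> t _; exact: integral_ge0.
- move=> t; rewrite /= !in_itv/= => /andP[Tt ->]; rewrite andbT; lra.
Qed.
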